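(* Let $\Delta_E\subset\mathbb{R}^2$ be an equilateral triangle of unit area. If nested uniform digit scrambling is applied to the base $4$ digits of $i-1$ in the triangular van der Corput construction on $\Delta_E$, then the resulting points $\boldsymbol{x}_i$ for $i=1,\dots,N=4^k$ are independent and uniformly distributed within their subtriangles (among the $N=4^k$ congruent level-$k$ subtriangles of $\Delta_E$). In that case, if $f$ has bounded first derivative on $\Delta_E$, then $$\mathbb{E}\Bigl(\Bigl(\frac1N\sum_{i=1}^N f(\boldsymbol{x}_i)-\int_{\Delta_E}f(\boldsymbol{x})\,\mathrm{d}\boldsymbol{x}\Bigr)^2\Bigr)=O\Bigl(\frac1{N^2}\Bigr).$$
   Context: Subtriangles. For a triangle $T=\Delta(A,B,C)$ with ordered vertices and a digit $d\in\{0,1,2,3\}$ define the subtriangle $T(d)$ (with ordered vertices) by $T(0)=\Delta(\frac{B+C}2,\frac{A+C}2,\frac{A+B}2)$, $T(1)=\Delta(A,\frac{A+B}2,\frac{A+C}2)$, $T(2)=\Delta(\frac{B+A}2,B,\frac{B+C}2)$, $T(3)=\Delta(\frac{C+A}2,\frac{C+B}2,C)$, where $\Delta(\cdot,\cdot,\cdot)$ denotes the closed triangle with the given vertices. Recursively, $T(d_1,\dots,d_K)=(T(d_1,\dots,d_{K-1}))(d_K)$. The level-$k$ subtriangles of $T$ are the $4^k$ congruent triangles $T(d_1,\dots,d_k)$. Triangular van der Corput points. Without scrambling, the $i$-th point ($i\ge1$) is obtained by writing $i-1=\sum_{j\ge1}d_j4^{j-1}$ with $d_j\in\{0,1,2,3\}$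 and taking the unique point of $\bigcap_{K\ge1}T(d_1,\dots,d_K)$ with $T=\Delta_E$; equivalently, the centroid of $T(d_1,\dots,d_K)$ for any $K$ such that $d_j=0$ for all $j>K$. Nested uniform digit scrambling (due to Owen). Take independent uniformly distributed random permutations of $\{0,1,2,3\}$: one permutation $\pi_{\emptyset}$, and one permutation $\pi_{d_1\cdots d_j}$ for each $j\ge1$ and each $(d_1,\dots,d_j)\in\{0,1,2,3\}^j$. Replace the digits $d_1,d_2,\dots$ of $i-1$ by $e_1=\pi_{\emptyset}(d_1)$, $e_{j+1}=\pi_{d_1\cdots d_j}(d_{j+1})$ for $j\ge1$. The scrambled point $\boldsymbol{x}_i$ is the unique point of $\bigcap_{K\ge1}T(e_1,\dots,e_K)$ with $T=\Delta_E$. *)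

(* Defs.v *)
From mathcomp Require Import all_boot all_order all_algebra perm.
From mathcomp Require Import all_classical all_reals all_analysis.

Set Implicit Arguments.
Unset Strict Implicit.
Unset Printing Implicit Defensive.

Import Order.TTheory GRing.Theory Num.Theory.
Import numFieldNormedType.Exports.

Local Open Scope classical_set_scope.
Local Open Scope ring_scope.

Section Triangles.
Context {R : realType}.

(* The norm that the library puts on [R * R] is the max-norm, so Euclidean
   lengths have to be written out. *)
Definition edist (p q : R * R) : R :=
  Num.sqrt ((p.1 - q.1) ^+ 2 + (p.2 - q.2) ^+ 2).

Definition lebesgue2 := (@lebesgue_measure R \x @lebesgue_measure R)%E.

Record triangle := Triangle { vA : R * R; vB : R * R; vC : R * R }.

Definition closed_triangle (T : triangle) : set (R * R) :=
  [set p | exists a b c : R, [/\ 0 <= a, 0 <= b, 0 <= c, a + b + c = 1 &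
             p = a *: vA T + b *: vB T + c *: vC T]].

Definition equilateral (T : triangle) : Prop :=
  edist (vA T) (vB T) = edist (vB T) (vC T) /\
  edist (vB T) (vC T) = edist (vC T) (vA T).

Definition midpoint (p q : R * R) : R * R := 2^-1 *: (p + q).

Definition child (T : triangle) (d : 'I_4) : triangle :=
  let: Triangle A B C := T in
  match val d with
  | 0%N => Triangle (midpoint B C) (midpoint A C) (midpoint A B)
  | 1%N => Triangle A (midpoint A B) (midpoint A C)
  | 2%N => Triangle (midpoint B A) B (midpoint B C)
  | _ => Triangle (midpoint C A) (midpoint C B) C
  end.

Definition subtriangle (T : triangle) (ds : seq 'I_4) : triangle :=
  foldl child T ds.

(* [g x] is the gradient of [f] at [x].  The increments are restricted to [D],
   so at boundary points of [D] this is differentiability relative to [D], and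
   the values of [f] outside [D] are irrelevant.  Using the max-norm on [R * R]
   is harmless here, all norms on the plane being equivalent. *)
Definition bounded_first_derivative (D : set (R * R)) (f : R * R -> R) : Prop :=
  exists g : R * R -> R * R,
    (forall x, D x ->
      let F := within D (nbhs x) in
      (fun y => f y - f x - ((g x).1 * (y.1 - x.1) + (g x).2 * (y.2 - x.2)))
        =o_F (fun y => y - x)) /\
    exists M : R, forall x, D x -> `|g x| <= M.

End Triangles.
Arguments triangle R : clear implicits.
Arguments lebesgue2 R : clear implicits.

Section Independence.
Context {d : measure_display} {Omega : measurableType d} {R : realType}.

(* Only meaningful when [P E > 0]. *)
Definition conditional (P : set Omega -> \bar R) (E : set Omega) :
  set Omega -> \bar R := fun A => (P (A `&` E) / P E)%E.

(* [G] is the sigma-algebra on the common codomain of the family. *)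
Definition mutually_independent (I : eqType) (U : Type) (G : set (set U))
    (P : set Omega -> \bar R) (X : I -> Omega -> U) : Prop :=
  (forall i B, G B -> measurable (X i @^-1` B)) /\
  forall (J : seq I) (B : I -> set U), uniq J -> (forall i, G (B i)) ->
    P (\bigcap_(i in [set` J]) (X i @^-1` B i)) =
    (\prod_(i <- J) P (X i @^-1` B i))%E.

Definition uniform_on (S : set (R * R)) (P : set Omega -> \bar R)
    (X : Omega -> R * R) : Prop :=
  forall B : set (measurableTypeR R * measurableTypeR R), measurable B ->
    P (X @^-1` B) = (lebesgue2 R (B `&` S) / lebesgue2 R S)%E.

End Independence.

Section Scrambling.
Context {d : measure_display} {Omega : measurableType d} {R : realType}.

(* [digit n j] is the coefficient of [4 ^ j] in [n], so that the digits
   d_1, d_2, ... of [n] are [digit n 0], [digit n 1], ... *)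
Definition digit (n j : nat) : 'I_4 := inord ((n %/ 4 ^ j) %% 4).

Definition digits (n K : nat) : seq 'I_4 := mkseq (digit n) K.

(* [pi w] is the permutation attached to the word [w]; all subsets of the
   finite type of permutations are taken as measurable. *)
Definition nested_uniform_scrambling (P : probability Omega R)
    (pi : seq 'I_4 -> Omega -> {perm 'I_4}) : Prop :=
  mutually_independent setT P pi /\
  forall w (s : {perm 'I_4}), P (pi w @^-1` [set s]) = ((4`!)%:R^-1)%:E.

(* The word e_1 ... e_K of the [i]-th point; points are numbered from 1. *)
Definition scrambled_digits (pi : seq 'I_4 -> Omega -> {perm 'I_4})
    (K i : nat) (w : Omega) : seq 'I_4 :=
  mkseq (fun j => pi (digits i.-1 j) w (digit i.-1 j)) K.

(* The intersection is a singleton; [get] returns its element. *)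
Definition scrambled_point (T : triangle R)
    (pi : seq 'I_4 -> Omega -> {perm 'I_4}) (i : nat) (w : Omega) : R * R :=
  get (\bigcap_(K in [set K | (1 <= K)%N])
         closed_triangle (subtriangle T (scrambled_digits pi K i w))).

End Scrambling.

(* Main.v *)
(* The permutations that produce the digits of a point after the k-th one are
   attached to words that begin with the first k digits of its index.  Hence for
   indices below 4^k they are pairwise distinct, and distinct from the
   permutations that decide which level-k subtriangles are assigned.  So, given
   the assignment, all later digits are independent and uniform.  A point with
   uniform digits gives each cell of each level the same mass as the normalized
   area does; since few cells meet the boundary of a quadrant, the two measures
   agree on quadrants, hence on all Borel sets.

   For the mean square error, replace f at each point by its value at a vertex
   of the level-2k cell of the point, which changes the average by O(4^-k)
   because f is Lipschitz.  The centred values are uncorrelated and of size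
   O(2^-k), so their sum over the 4^k points has bounded second moment. *)
Require Import Defs.
From mathcomp Require Import all_boot all_order all_algebra perm.
From mathcomp Require Import all_classical all_reals all_analysis measurable_realfun.
From mathcomp Require Import ring lra.

Set Implicit Arguments.
Unset Strict Implicit.
Unset Printing Implicit Defensive.

Import Order.TTheory GRing.Theory Num.Theory.
Import numFieldNormedType.Exports.

Local Open Scope classical_set_scope.
Local Open Scope ring_scope.

(** Closed cells share edges and vertices, so a word of digits confines a point to a cell, while the
    position of the point does not determine the word. Transfers from words to positions are
    therefore inclusions used in one direction, and no argument that cell edges are negligible is
    made. An event about the exact position of a point involves infinitely many permutations,
    whereas the hypothesis on [pi] concerns finitely many at a time. The bridge is the invariant
    [independent_off V F]: [F] is independent of every finite prescription of values at words
    outside [V]. It holds for an assignment of cells, with [V] the words shorter than k, and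
    survives intersection with a position event of a further point, [V] growing by the words of that
    point. Iterating over the points gives their joint law. In the error estimate the k leading
    digits contribute no variance, since each cell is used exactly once; only the spread within
    cells remains. *)

Section Geometry.
Context {R : realType}.
Implicit Types (T : triangle R) (p q x y : R * R).

(** * Triangles, barycentric coordinates and the subdivision into four *)

Lemma pairP (p q : R * R) : p.1 = q.1 -> p.2 = q.2 -> p = q.
Proof. by case: p q => [a b] [c e] /= -> ->. Qed.

Lemma in_triangle T x : closed_triangle T x <-> exists a b c : R,
  [/\ [/\ 0 <= a, 0 <= b & 0 <= c], a + b + c = 1,
    x.1 = a * (vA T).1 + b * (vB T).1 + c * (vC T).1 &
    x.2 = a * (vA T).2 + b * (vB T).2 + c * (vC T).2].
Proof.
split=> [[a [b [c [a0 b0 c0 abc ->]]]]|[a [b [c [[a0 b0 c0] abc x1 x2]]]]];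
  exists a, b, c; split=> //.
exact: pairP.
Qed.

(** Twice the signed area. [bary_B] and [bary_C] are the numerators in Cramer's rule for the
    barycentric coordinates at [vB] and [vC]. *)
Definition triangle_det T : R :=
  ((vB T).1 - (vA T).1) * ((vC T).2 - (vA T).2) -
  ((vB T).2 - (vA T).2) * ((vC T).1 - (vA T).1).

Definition bary_B T x : R :=
  (x.1 - (vA T).1) * ((vC T).2 - (vA T).2) -
  (x.2 - (vA T).2) * ((vC T).1 - (vA T).1).

Definition bary_C T x : R :=
  ((vB T).1 - (vA T).1) * (x.2 - (vA T).2) -
  ((vB T).2 - (vA T).2) * (x.1 - (vA T).1).

(** Replaces the existential over weights by three inequalities between explicit functions of [x],
    from which measurability and closedness can be read off. *)
Lemma triangle_halfplanes T x : triangle_det T != 0 ->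
  closed_triangle T x <->
  [/\ 0 <= bary_B T x / triangle_det T, 0 <= bary_C T x / triangle_det T &
      bary_B T x / triangle_det T + bary_C T x / triangle_det T <= 1].
Proof.
move=> d0; rewrite in_triangle; split.
  move=> [a [b [c [[a0 b0 c0] abc x1 x2]]]].
  have -> : bary_B T x / triangle_det T = b.
    apply: (canLR (mulfK d0)).
    by rewrite /bary_B /triangle_det x1 x2 (_ : a = 1 - b - c); [ring|lra].
  have -> : bary_C T x / triangle_det T = c.
    apply: (canLR (mulfK d0)).
    by rewrite /bary_C /triangle_det x1 x2 (_ : a = 1 - b - c); [ring|lra].
  by split=> //; lra.
set b := bary_B T x / _; set c := bary_C T x / _ => -[b0 c0 bc].
have bE : bary_B T x = b * triangle_det T by rewrite divfK.
have cE : bary_C T x = c * triangle_det T by rewrite divfK.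
clearbody b c.
exists (1 - b - c), b, c; split; [by split=> //; lra|by ring| |];
  apply: (mulIf d0).
  transitivity ((vA T).1 * triangle_det T +
      (b * triangle_det T) * ((vB T).1 - (vA T).1) +
      (c * triangle_det T) * ((vC T).1 - (vA T).1)); last by ring.
  by rewrite -bE -cE /bary_B /bary_C /triangle_det; ring.
transitivity ((vA T).2 * triangle_det T +
    (b * triangle_det T) * ((vB T).2 - (vA T).2) +
    (c * triangle_det T) * ((vC T).2 - (vA T).2)); last by ring.
by rewrite -bE -cE /bary_B /bary_C /triangle_det; ring.
Qed.

(** A crude common bound for the coordinates of points of [T]; it enters only through constants. *)
Definition triangle_radius T : R :=
  `|(vA T).1| + `|(vB T).1| + `|(vC T).1| +
  (`|(vA T).2| + `|(vB T).2| + `|(vC T).2|).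

Lemma triangle_radius_ge0 T : 0 <= triangle_radius T.
Proof. by rewrite !addr_ge0. Qed.

Lemma triangle_bound T x : closed_triangle T x ->
  `|x.1| <= triangle_radius T /\ `|x.2| <= triangle_radius T.
Proof.
rewrite in_triangle => -[a [b [c [[a0 b0 c0] abc x1 x2]]]].
have key (u v w : R) : `|a * u + b * v + c * w| <= `|u| + `|v| + `|w|.
  have a1 : a <= 1 by lra. have b1 : b <= 1 by lra. have c1 : c <= 1 by lra.
  rewrite (le_trans (ler_normD _ _))// lerD//.
    rewrite (le_trans (ler_normD _ _))// lerD//.
      by rewrite normrM ger0_norm// ler_piMl.
    by rewrite normrM ger0_norm// ler_piMl.
  by rewrite normrM ger0_norm// ler_piMl.
split; [rewrite x1 (le_trans (key _ _ _))// lerDl|rewrite x2 (le_trans (key _ _ _))// lerDr];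
 by rewrite !addr_ge0.
Qed.

Lemma triangle_vA T : closed_triangle T (vA T).
Proof. by apply/in_triangle; exists 1, 0, 0; split; [split| | |]; ring || lra. Qed.

Lemma triangle_convex T x y t : 0 <= t <= 1 ->
  closed_triangle T x -> closed_triangle T y ->
  closed_triangle T (x + t *: (y - x)).
Proof.
move=> /andP[t0 t1] /in_triangle[a [b [c [[a0 b0 c0] abc x1 x2]]]].
move=> /in_triangle[a' [b' [c' [[a0' b0' c0'] abc' y1 y2]]]].
apply/in_triangle.
exists ((1 - t) * a + t * a'), ((1 - t) * b + t * b'), ((1 - t) * c + t * c').
have t1' : 0 <= 1 - t by lra.
split; [by split; rewrite addr_ge0// mulr_ge0| | |].
- have -> : a' = 1 - b' - c' by lra.
  have -> : a = 1 - b - c by lra.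
  by ring.
- by rewrite /= /GRing.scale /= y1 x1; ring.
- by rewrite /= /GRing.scale /= y2 x2; ring.
Qed.

Lemma ord4_case (e : 'I_4) : [\/ val e = 0, val e = 1, val e = 2 | val e = 3]%N.
Proof. by case: e => [[|[|[|[|m]]]] //= _]; constructor. Qed.

(** The medial child is a half-turned copy, with ratio -1/2, hence the absolute value. The order of
    vertices in [child] is what makes them correspond under a homothety in all four cases. *)
Lemma child_homothety T e : exists (r : R) (z : R * R),
  [/\ `|r| = 2^-1, vA (child T e) = z + r *: vA T,
      vB (child T e) = z + r *: vB T & vC (child T e) = z + r *: vC T].
Proof.
have h0 : 2^-1 > 0 :> R by lra.
case: T => A B C; case: (ord4_case e) => ee; rewrite /child ee /=.
- exists (- 2^-1), (2^-1 *: (A + B + C)); rewrite normrN gtr0_norm//.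
  by split=> //; apply: pairP; rewrite /midpoint /= /GRing.scale /=; lra.
- exists 2^-1, (2^-1 *: A); rewrite gtr0_norm//.
  by split=> //; apply: pairP; rewrite /midpoint /= /GRing.scale /=; lra.
- exists 2^-1, (2^-1 *: B); rewrite gtr0_norm//.
  by split=> //; apply: pairP; rewrite /midpoint /= /GRing.scale /=; lra.
- exists 2^-1, (2^-1 *: C); rewrite gtr0_norm//.
  by split=> //; apply: pairP; rewrite /midpoint /= /GRing.scale /=; lra.
Qed.

Lemma child_subset T e : closed_triangle (child T e) `<=` closed_triangle T.
Proof.
move=> x /in_triangle[a [b [c [[a0 b0 c0] abc x1 x2]]]]; apply/in_triangle.
move: x1 x2; case: T => A B C; case: (ord4_case e) => ee; rewrite /child ee /=.
all: rewrite /midpoint /GRing.scale /= => x1 x2.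
- exists (2^-1 * (b + c)), (2^-1 * (a + c)), (2^-1 * (a + b)).
  by split; [split| | |]; lra.
- exists (a + 2^-1 * (b + c)), (2^-1 * b), (2^-1 * c).
  by split; [split| | |]; lra.
- exists (2^-1 * a), (b + 2^-1 * (a + c)), (2^-1 * c).
  by split; [split| | |]; lra.
- exists (2^-1 * a), (2^-1 * b), (c + 2^-1 * (a + b)).
  by split; [split| | |]; lra.
Qed.

Lemma child_cover T x : closed_triangle T x ->
  exists e, closed_triangle (child T e) x.
Proof.
move=> /in_triangle[a [b [c [[a0 b0 c0] abc x1 x2]]]].
move: x1 x2; case: T => A B C /= x1 x2.
have aE : a = 1 - b - c by lra.
subst a.
(* A weight of at least 1/2 places [x] in the corner child at that vertex; if all three are smaller,
   [x] is in the medial child. *)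
have [ha|ha] := leP 2^-1 (1 - b - c).
  exists (inord 1); apply/in_triangle; rewrite /child /= inordK//=.
  exists (2 * (1 - b - c) - 1), (2 * b), (2 * c); rewrite /midpoint /= /GRing.scale /=.
  by split; [split| | |]; lra.
have [hb|hb] := leP 2^-1 b.
  exists (inord 2); apply/in_triangle; rewrite /child /= inordK//=.
  exists (2 * (1 - b - c)), (2 * b - 1), (2 * c); rewrite /midpoint /= /GRing.scale /=.
  by split; [split| | |]; lra.
have [hc|hc] := leP 2^-1 c.
  exists (inord 3); apply/in_triangle; rewrite /child /= inordK//=.
  exists (2 * (1 - b - c)), (2 * b), (2 * c - 1); rewrite /midpoint /= /GRing.scale /=.
  by split; [split| | |]; lra.
exists (inord 0); apply/in_triangle; rewrite /child /= inordK//=.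
exists (1 - 2 * (1 - b - c)), (1 - 2 * b), (1 - 2 * c).
rewrite /midpoint /= /GRing.scale /=.
by split; [split| | |]; lra.
Qed.

Lemma subtriangle_cat T u v :
  subtriangle T (u ++ v) = subtriangle (subtriangle T u) v.
Proof. exact: foldl_cat. Qed.

Lemma subtriangle_rcons T u e :
  subtriangle T (rcons u e) = child (subtriangle T u) e.
Proof. exact: foldl_rcons. Qed.

Lemma subtriangle_subset T u : closed_triangle (subtriangle T u) `<=` closed_triangle T.
Proof.
elim/last_ind: u => [//|u e IH]; rewrite subtriangle_rcons.
by apply: (subset_trans _ IH); exact: child_subset.
Qed.

Lemma subtriangle_cover T K x : closed_triangle T x ->
  exists u : K.-tuple 'I_4, closed_triangle (subtriangle T u) x.
Proof.
move=> Tx; elim: K => [|K [u ux]]; first by exists [tuple].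
have [e ex] := child_cover ux.
by exists [tuple of rcons u e]; rewrite /= subtriangle_rcons.
Qed.

Lemma subtriangle_homothety T u : exists (r : R) (z : R * R),
  [/\ `|r| = 2^-1 ^+ size u, vA (subtriangle T u) = z + r *: vA T,
      vB (subtriangle T u) = z + r *: vB T & vC (subtriangle T u) = z + r *: vC T].
Proof.
elim/last_ind: u => [|u e [r [z [rE aE bE cE]]]].
  by exists 1, 0; rewrite normr1 !add0r !scale1r.
have [s [z' [sE aE' bE' cE']]] := child_homothety (subtriangle T u) e.
exists (s * r), (z' + s *: z); rewrite subtriangle_rcons aE' bE' cE' aE bE cE.
rewrite size_rcons exprS normrM sE rE; split=> //;
 by rewrite scalerDr scalerA addrA.
Qed.

(** Membership through the inverse homothety exhibits a cell as a preimage of [T], the form in which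
    closedness, measurability and area are transported. *)
Lemma closed_subtriangleE T u : exists (r : R) (z : R * R),
  [/\ `|r| = 2^-1 ^+ size u &
      forall x, closed_triangle (subtriangle T u) x <->
        closed_triangle T (r^-1 * (x.1 - z.1), r^-1 * (x.2 - z.2))].
Proof.
have [r [z [rE aE bE cE]]] := subtriangle_homothety T u.
exists r, z; split=> // x.
have r0 : r != 0 by rewrite -normr_gt0 rE exprn_gt0// invr_gt0.
rewrite !in_triangle aE bE cE; split=> - [a [b [c [abc0 abc x1 x2]]]];
  exists a, b, c; split=> //.
- rewrite x1 /= /GRing.scale /=; have -> : a = 1 - b - c by lra.
  by field.
- rewrite x2 /= /GRing.scale /=; have -> : a = 1 - b - c by lra.
  by field.
- move: x1 => /= /(congr1 (fun t => z.1 + r * t)); rewrite mulrA mulfV// mul1r addrC subrK => ->.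
  rewrite /GRing.scale /=; have -> : a = 1 - b - c by lra.
  by ring.
- move: x2 => /= /(congr1 (fun t => z.2 + r * t)); rewrite mulrA mulfV// mul1r addrC subrK => ->.
  rewrite /GRing.scale /=; have -> : a = 1 - b - c by lra.
  by ring.
Qed.

Lemma subtriangle_diam T u x y :
  closed_triangle (subtriangle T u) x -> closed_triangle (subtriangle T u) y ->
  `|x.1 - y.1| <= 2 * triangle_radius T * 2^-1 ^+ size u /\
  `|x.2 - y.2| <= 2 * triangle_radius T * 2^-1 ^+ size u.
Proof.
have [r [z [rE H]]] := closed_subtriangleE T u.
have r0 : r != 0 by rewrite -normr_gt0 rE exprn_gt0// invr_gt0.
move=> /H/triangle_bound[/= x1 x2] /H/triangle_bound[/= y1 y2]; rewrite -rE.
have key a b c : `|r^-1 * (a - c)| <= triangle_radius T ->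
    `|r^-1 * (b - c)| <= triangle_radius T ->
    `|a - b| <= 2 * triangle_radius T * `|r|.
  move=> ha hb; rewrite -ler_pdivrMr ?normr_gt0// -normfV -normrM.
  have -> : (a - b) / r = r^-1 * (a - c) - r^-1 * (b - c) by field.
  by rewrite (le_trans (ler_normB _ _))//; lra.
by split; [exact: key x1 y1|exact: key x2 y2].
Qed.

End Geometry.

(** * Measurability, closedness and area of the cells *)

Section TriangleMeasure.
Context {R : realType}.
Implicit Types (T : triangle R).
Local Notation RR := (measurableTypeR R * measurableTypeR R)%type.
Local Notation lambda := (@lebesgue_measure R).

Lemma lebesgue2_setX (A B : set (measurableTypeR R)) :
  measurable A -> measurable B ->
  lebesgue2 R (A `*` B) = (lambda A * lambda B)%E.
Proof. exact: product_measure1E. Qed.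

Lemma measurable_bary_B T : measurable_fun setT (bary_B T : RR -> R).
Proof.
rewrite /bary_B.
by apply: measurable_funB; apply: measurable_funM => //;
   apply: measurable_funB.
Qed.

Lemma measurable_bary_C T : measurable_fun setT (bary_C T : RR -> R).
Proof.
rewrite /bary_C.
by apply: measurable_funB; apply: measurable_funM => //;
   apply: measurable_funB.
Qed.

Lemma triangle_halfplanesE T : triangle_det T != 0 ->
  closed_triangle T = (fun x => bary_B T x / triangle_det T) @^-1` [set t | 0 <= t] `&`
    (fun x => bary_C T x / triangle_det T) @^-1` [set t | 0 <= t] `&`
    (fun x => bary_B T x / triangle_det T + bary_C T x / triangle_det T) @^-1` [set t | t <= 1].
Proof.
move=> d0; apply/seteqP; split=> x.
  by move/(triangle_halfplanes x d0) => [].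
by move=> [[? ?] ?]; apply/(triangle_halfplanes x d0); split.
Qed.

Lemma measurable_triangle T : triangle_det T != 0 ->
  measurable (closed_triangle T : set RR).
Proof.
move=> d0; rewrite triangle_halfplanesE//.
have mB : measurable_fun setT (fun x : RR => bary_B T x / triangle_det T).
  by apply: measurable_funM => //; exact: measurable_bary_B.
have mC : measurable_fun setT (fun x : RR => bary_C T x / triangle_det T).
  by apply: measurable_funM => //; exact: measurable_bary_C.
apply: measurableI; first apply: measurableI.
- rewrite -[X in measurable X]setTI; apply: mB => //.
  by rewrite -set_itvcy; exact: measurable_itv.
- rewrite -[X in measurable X]setTI; apply: mC => //.
  by rewrite -set_itvcy; exact: measurable_itv.
- rewrite -[X in measurable X]setTI; apply: (measurable_funD mB mC) => //.
  by rewrite -set_itvNyc; exact: measurable_itv.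
Qed.

Lemma closed_triangle_closed T : triangle_det T != 0 -> closed (closed_triangle T).
Proof.
move=> d0; rewrite triangle_halfplanesE//.
have cB : continuous (fun x => bary_B T x / triangle_det T).
  move=> x; rewrite /bary_B; apply: cvgMl => //.
  apply: cvgB; apply: cvgMl => //; apply: cvgB; try exact: cvg_cst;
   [exact: cvg_fst|exact: cvg_snd].
have cC : continuous (fun x => bary_C T x / triangle_det T).
  move=> x; rewrite /bary_C; apply: cvgMl => //.
  apply: cvgB; apply: cvgMr => //; apply: cvgB; try exact: cvg_cst;
   [exact: cvg_snd|exact: cvg_fst].
apply: closedI; first apply: closedI.
- by apply: closed_comp => [x _|]; [exact: cB|exact: closed_ge].
- by apply: closed_comp => [x _|]; [exact: cC|exact: closed_ge].
- apply: closed_comp => [x _|]; last exact: closed_le.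
  by apply: cvgD; [exact: cB|exact: cC].
Qed.

(** Two side vectors of squared length L have scalar product L/2, as all sides are equal. If the
    determinant vanished, Lagrange's identity would give L^2 = L^2/4, so [T] would be a single point
    of area 0. *)
Lemma equilateral_det_neq0 T : equilateral T ->
  lebesgue2 R (closed_triangle T) = 1%E -> triangle_det T != 0.
Proof.
move=> [e1 e2] area; apply/eqP => d0.
have sq (a b : R * R) : Defs.edist a b ^+ 2 = (a.1 - b.1) ^+ 2 + (a.2 - b.2) ^+ 2.
  by rewrite /Defs.edist sqr_sqrtr// addr_ge0// sqr_ge0.
have := congr1 (fun t => t ^+ 2) e1; have := congr1 (fun t => t ^+ 2) e2.
rewrite /= !sq; move: d0; rewrite /triangle_det.
set u := (vB T).1 - (vA T).1; set v := (vB T).2 - (vA T).2.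
set s := (vC T).1 - (vA T).1; set t := (vC T).2 - (vA T).2.
move=> d0 h2 h1.
have hs : (u - s) ^+ 2 + (v - t) ^+ 2 = s ^+ 2 + t ^+ 2.
  by rewrite -h2 /u /v /s /t; ring.
have hu : u ^+ 2 + v ^+ 2 = s ^+ 2 + t ^+ 2.
  by rewrite -hs; move: h1; rewrite /u /v /s /t => h1; lra.
have L0 : (s ^+ 2 + t ^+ 2) ^+ 2 = 0.
  have dot : 2 * (u * s + v * t) = s ^+ 2 + t ^+ 2 by lra.
  have : (u * t - v * s) ^+ 2 + (u * s + v * t) ^+ 2 = (u ^+ 2 + v ^+ 2) * (s ^+ 2 + t ^+ 2).
    by ring.
  rewrite d0 hu (_ : u * s + v * t = (s ^+ 2 + t ^+ 2) / 2); last lra.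
  by move: (s ^+ 2 + t ^+ 2) => L hL; nra.
have st0 : s ^+ 2 + t ^+ 2 = 0 by apply/eqP; rewrite -sqrf_eq0 L0.
have sos (a b : R) : a ^+ 2 + b ^+ 2 = 0 -> a = 0 /\ b = 0.
  move/eqP; rewrite paddr_eq0 ?sqr_ge0// !sqrf_eq0.
  by move=> /andP[/eqP ? /eqP ?].
have [s0 t0] := sos _ _ st0.
have [u0 v0] : u = 0 /\ v = 0 by apply: sos; rewrite hu.
have TA : closed_triangle T = [set (vA T).1] `*` [set (vA T).2].
  apply/seteqP; split=> x.
    move/in_triangle => [a [b [c [_ abc x1 x2]]]]; split=> /=.
      rewrite x1 (_ : (vB T).1 = (vA T).1); last by rewrite /u in u0; lra.
      rewrite (_ : (vC T).1 = (vA T).1); last by rewrite /s in s0; lra.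
      by rewrite -!mulrDl abc mul1r.
    rewrite x2 (_ : (vB T).2 = (vA T).2); last by rewrite /v in v0; lra.
    rewrite (_ : (vC T).2 = (vA T).2); last by rewrite /t in t0; lra.
    by rewrite -!mulrDl abc mul1r.
  by case: x => x1 x2 [/= -> ->]; have := triangle_vA T; case: (vA T).
move: area; rewrite TA lebesgue2_setX// lebesgue_measure_set1.
by rewrite mul0e => /eqP; rewrite eq_sym onee_eq0.
Qed.

Lemma measurable_affine (r z : R) :
  measurable_fun setT (fun x : measurableTypeR R => r^-1 * (x - z) : measurableTypeR R).
Proof. by apply: measurable_funM => //; exact: measurable_funB. Qed.

(** By uniqueness of Lebesgue measure: the pushforward, scaled by 1/|r|, gives half-open intervals
    their length. For [r < 0] the preimage is half-open at the other end, with the same length. *)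
Lemma lebesgue_measure_affine (r z : R) (A : set (measurableTypeR R)) : r != 0 ->
  measurable A ->
  lambda ((fun x => r^-1 * (x - z)) @^-1` A) = (`|r|%:E * lambda A)%E.
Proof.
move=> r0 mA.
have nr0 : 0 < `|r| by rewrite normr_gt0.
pose phi : measurableTypeR R -> measurableTypeR R := fun x => r^-1 * (x - z).
have mphi : measurable_fun setT phi := measurable_affine r z.
have nV0 : 0 <= `|r|^-1 by rewrite invr_ge0 ltW.
pose m0 : {measure set (measurableTypeR R) -> \bar R} :=
  mscale (NngNum nV0) (pushforward lambda phi).
pose m := m0 mphi.
have mE B : m B = (`|r|^-1%:E * lambda (phi @^-1` B))%E by [].
have -> : lambda A = m A.
  apply: lebesgue_measure_unique => // _ [[a b] _ <-].
  rewrite mE.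
  have [rp|rn] := ltP 0 r.
    have -> : phi @^-1` `]a, b]%classic = `]z + r * a, z + r * b]%classic.
      apply/funext => x; apply/propext; rewrite /phi /= !in_itv /=.
      rewrite [r^-1 * _]mulrC ltr_pdivlMr// ler_pdivrMr//.
      by split=> /andP[? ?]; apply/andP; split; lra.
    rewrite !lebesgue_measure_itv /= !lte_fin ltrD2l ltr_pM2l//.
    case: ifP => _; last by rewrite mule0.
    rewrite -!EFinB -EFinM; congr (_%:E).
    by rewrite gtr0_norm//; field.
  have {}rn : r < 0 by rewrite lt_neqAle r0.
  have -> : phi @^-1` `]a, b]%classic = `[z + r * b, z + r * a[%classic.
    apply/funext => x; apply/propext; rewrite /phi /= !in_itv /=.
    rewrite [r^-1 * _]mulrC ltr_ndivlMr// ler_ndivrMr//.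
    by split=> /andP[? ?]; apply/andP; split; lra.
  rewrite !lebesgue_measure_itv /= !lte_fin ltrD2l ltr_nM2l//.
  case: ifP => _; last by rewrite mule0.
  rewrite -!EFinB -EFinM; congr (_%:E).
  by rewrite ltr0_norm//; field.
rewrite mE muleA -EFinM mulfV ?mul1e//.
by rewrite gt_eqF.
Qed.

Lemma lebesgue2_affine (r : R) (z : R * R) (A : set RR) : r != 0 ->
  measurable A ->
  lebesgue2 R ((fun x : RR => (r^-1 * (x.1 - z.1), r^-1 * (x.2 - z.2)) : RR) @^-1` A) =
  ((r ^+ 2)%:E * lebesgue2 R A)%E.
Proof.
move=> r0 mA.
have r20 : 0 < r ^+ 2 by rewrite lt_neqAle eq_sym sqrf_eq0 r0 sqr_ge0.
pose phi : RR -> RR := fun x => (r^-1 * (x.1 - z.1), r^-1 * (x.2 - z.2)).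
have mphi : measurable_fun setT phi.
  by apply: measurable_fun_pair; apply: measurable_funM => //; apply: measurable_funB.
have nV0 : 0 <= (r ^+ 2)^-1 by rewrite invr_ge0 ltW.
pose m0 : {measure set RR -> \bar R} :=
  mscale (NngNum nV0) (pushforward (lambda \x lambda)%E phi).
pose m := m0 mphi.
have mE B : m B = ((r ^+ 2)^-1%:E * lebesgue2 R (phi @^-1` B))%E by [].
have -> : lebesgue2 R A = m A.
  apply: product_measure_unique => // B C mB mC.
  rewrite mE.
  have -> : phi @^-1` (B `*` C) =
    ((fun x => r^-1 * (x - z.1)) @^-1` B) `*` ((fun x => r^-1 * (x - z.2)) @^-1` C).
    by [].
  have mp (c : R) (D : set (measurableTypeR R)) : measurable D ->
     measurable ((fun x : measurableTypeR R => r^-1 * (x - c)) @^-1` D).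
    by move=> mD; rewrite -[X in measurable X]setTI; exact: measurable_affine.
  rewrite lebesgue2_setX; [|exact: mp|exact: mp].
  rewrite !lebesgue_measure_affine// muleACA -EFinM -expr2 real_normK ?num_real//.
  by rewrite [LHS]muleA -EFinM mulVf ?mul1e// gt_eqF.
rewrite mE muleA -EFinM mulfV ?mul1e//.
by rewrite gt_eqF.
Qed.

Lemma measurable_subtriangle T u : triangle_det T != 0 ->
  measurable (closed_triangle (subtriangle T u) : set RR).
Proof.
move=> d0; have [r [z [rE H]]] := closed_subtriangleE T u.
rewrite (_ : closed_triangle _ =
  (fun x : RR => (r^-1 * (x.1 - z.1), r^-1 * (x.2 - z.2)) : RR) @^-1` closed_triangle T).
  rewrite -[X in measurable X]setTI; apply: measurable_fun_pair => //.
  - by apply: measurable_funM => //; apply: measurable_funB.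
  - by apply: measurable_funM => //; apply: measurable_funB.
  - exact: measurable_triangle.
by apply/seteqP; split=> x; [move/H|move=> ?; apply/H].
Qed.

Lemma closed_subtriangle_closed T u : triangle_det T != 0 ->
  closed (closed_triangle (subtriangle T u)).
Proof.
move=> d0; have [r [z [rE H]]] := closed_subtriangleE T u.
rewrite (_ : closed_triangle _ =
  (fun x : R * R => (r^-1 * (x.1 - z.1), r^-1 * (x.2 - z.2))) @^-1` closed_triangle T).
  apply: closed_comp => [x _|]; last exact: closed_triangle_closed.
  have c1 : (r^-1 * (y.1 - z.1) : R) @[y --> x] --> (r^-1 * (x.1 - z.1) : R).
    by apply: cvgMr => //; apply: cvgB; [exact: cvg_fst|exact: cvg_cst].
  have c2 : (r^-1 * (y.2 - z.2) : R) @[y --> x] --> (r^-1 * (x.2 - z.2) : R).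
    by apply: cvgMr => //; apply: cvgB; [exact: cvg_snd|exact: cvg_cst].
  exact: (cvg_pair c1 c2).
by apply/seteqP; split=> x; [move/H|move=> ?; apply/H].
Qed.

Lemma lebesgue2_subtriangle T u : triangle_det T != 0 ->
  lebesgue2 R (closed_triangle (subtriangle T u)) =
  ((4^-1 ^+ size u)%:E * lebesgue2 R (closed_triangle T))%E.
Proof.
move=> d0; have [r [z [rE H]]] := closed_subtriangleE T u.
have r0 : r != 0 by rewrite -normr_gt0 rE exprn_gt0// invr_gt0.
rewrite (_ : closed_triangle (subtriangle T u) =
  (fun x : RR => (r^-1 * (x.1 - z.1), r^-1 * (x.2 - z.2)) : RR) @^-1` closed_triangle T).
  rewrite lebesgue2_affine//; last exact: measurable_triangle.
  congr (_%:E * _)%E; rewrite -[r ^+ 2]real_normK ?num_real// rE -exprM mulnC exprM.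
  by congr (_ ^+ _); field.
by apply/seteqP; split=> x; [move/H|move=> ?; apply/H].
Qed.

End TriangleMeasure.

(** * Events described by finitely many alternatives *)

Section FiniteUnions.
Context d (X : measurableType d) {R : realType}.

Lemma exists_bigsetU (I : finType) (p : pred I) (A : I -> set X) :
  [set x | exists i, p i /\ A i x] = \big[setU/set0]_(i | p i) A i.
Proof.
rewrite -bigcup_seq_cond; apply/seteqP; split=> x [i].
  by move=> [pi Ax]; exists i => //=; rewrite mem_index_enum.
by move=> /andP[_ pi] Ax; exists i.
Qed.

Lemma measurable_exists (I : finType) (p : pred I) (A : I -> set X) :
  (forall i, measurable (A i)) -> measurable [set x | exists i, p i /\ A i x].
Proof. by move=> mA; rewrite exists_bigsetU; exact: bigsetU_measurable. Qed.

Lemma measure_exists_le (m : {measure set X -> \bar R}) (I : finType) (p : pred I)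
    (A : I -> set X) :
  (forall i, measurable (A i)) ->
  (m [set x | exists i, p i /\ A i x] <= \sum_(i | p i) m (A i))%E.
Proof.
move=> mA; rewrite exists_bigsetU; elim: (index_enum I) => [|i s IH].
  by rewrite !big_nil measure0.
rewrite !big_cons; case: ifP => // _.
apply: (le_trans (measureU2 _ (mA i) _)); first exact: bigsetU_measurable.
exact: leeD.
Qed.

Lemma measure_fiber_sum (m : {measure set X -> \bar R}) (I : finType) (p : pred I)
    (Z : X -> I) (F : set X) :
  measurable F -> (forall i, measurable (Z @^-1` [set i])) ->
  m (F `&` [set x | p (Z x)]) = (\sum_(i | p i) m (F `&` Z @^-1` [set i]))%E.
Proof.
move=> mF mZ.
have -> : F `&` [set x | p (Z x)] = \big[setU/set0]_(i | p i) (F `&` Z @^-1` [set i]).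
  rewrite -exists_bigsetU; apply/seteqP; split=> x.
    by move=> [Fx px]; exists (Z x); do !split.
  by move=> [i [pi [Fx /= zi]]]; split=> //=; rewrite zi.
have : uniq (index_enum I) by exact: index_enum_uniq.
elim: (index_enum I) => [|i s IH] /=; first by rewrite !big_nil measure0.
move=> /andP[nis us]; rewrite !big_cons; case: ifP => [pi|_]; last exact: IH.
rewrite -IH// measureU//.
- exact: measurableI.
- by apply: bigsetU_measurable => j _; exact: measurableI.
- rewrite -bigcup_seq_cond; apply/seteqP; split=> x //.
  move=> [[_ /= Zi] [j /= /andP[js _] [_ Zj]]].
  by move: nis; rewrite -Zi Zj js.
Qed.

End FiniteUnions.

(** * Quadrants as a generating class of planar Borel sets *)

Section QuadrantGenerator.
Context {R : realType}.
Local Notation RR := (measurableTypeR R * measurableTypeR R)%type.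

(** Closed, so that limits of points of a quadrant stay in it; [subtriangle_quadrant_limit] relies
    on this. *)
Definition quadrant (a b : R) : set RR := [set x | a <= x.1 /\ b <= x.2].

Lemma quadrantE (a b : R) : quadrant a b =
  (`[a, +oo[%classic : set (measurableTypeR R)) `*`
  (`[b, +oo[%classic : set (measurableTypeR R)).
Proof. by apply/seteqP; split=> -[x y]; rewrite /quadrant /= !in_itv /= !andbT. Qed.

Lemma measurable_quadrant (a b : R) : measurable (quadrant a b).
Proof. by rewrite quadrantE; apply: measurableX; exact: measurable_itv. Qed.

Definition quadrants : set (set RR) := [set A | exists a b, A = quadrant a b].

Lemma quadrants_setI : setI_closed quadrants.
Proof.
move=> _ _ [a [b ->]] [a' [b' ->]]; exists (Num.max a a'), (Num.max b b').
apply/seteqP; split=> -[x y]; rewrite /quadrant /= !ge_max.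
  by move=> [[-> ->] [-> ->]].
by move=> [/andP[-> ->] /andP[-> ->]].
Qed.

(** A closed half-plane bounded below in one coordinate is a countable union of quadrants, so both
    projections are measurable for the generated sigma-algebra, and rectangles belong to it. *)
Lemma measurable_quadrantsE : @measurable _ RR = <<s quadrants >>.
Proof.
apply/seteqP; split; last first.
  apply: smallest_sub; first exact: sigma_algebra_measurable.
  by move=> _ [a [b ->]]; exact: measurable_quadrant.
pose Y := g_sigma_algebraType quadrants.
have m1 : measurable_fun setT (fst : Y -> measurableTypeR R).
  apply: (measurability _ (RGenCInfty.measurableE R)) => _ [_ [a ->] <-].
  rewrite setTI (_ : _ @^-1` _ = \bigcup_n quadrant a (- n%:R)).
    by apply: bigcupT_measurable => n; apply: sub_sigma_algebra; exists a, (- n%:R).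
  apply/seteqP; split=> -[x y]; rewrite /= in_itv /= andbT.
    move=> ax; exists (Num.truncn `|y|).+1 => //; split=> //=.
    rewrite lerNl (le_trans _ (ltW (truncnS_gt _)))// -normrN.
    exact: ler_norm.
  by move=> [n _ []].
have m2 : measurable_fun setT (snd : Y -> measurableTypeR R).
  apply: (measurability _ (RGenCInfty.measurableE R)) => _ [_ [b ->] <-].
  rewrite setTI (_ : _ @^-1` _ = \bigcup_n quadrant (- n%:R) b).
    by apply: bigcupT_measurable => n; apply: sub_sigma_algebra; exists (- n%:R), b.
  apply/seteqP; split=> -[x y]; rewrite /= in_itv /= andbT.
    move=> ax; exists (Num.truncn `|x|).+1 => //; split=> //=.
    rewrite lerNl (le_trans _ (ltW (truncnS_gt _)))// -normrN.
    exact: ler_norm.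
  by move=> [n _ []].
rewrite measurable_prod_measurableType; apply: smallest_sub.
  exact: smallest_sigma_algebra.
move=> _ [A mA [B mB <-]].
have -> : A `*` B = (fst @^-1` A) `&` (snd @^-1` B) by [].
apply: (@measurableI _ Y).
  by rewrite -[X in measurable X]setTI; exact: m1.
by rewrite -[X in measurable X]setTI; exact: m2.
Qed.

Lemma quadrants_cover : \bigcup_n quadrant (- n%:R) (- n%:R) = setT.
Proof.
apply/seteqP; split=> // -[x y] _.
exists (Num.truncn (`|x| + `|y|)).+1 => //; split=> /=;
  rewrite lerNl (le_trans _ (ltW (truncnS_gt _)))//.
- by rewrite (le_trans (ler_norm _))// normrN lerDl.
- by rewrite (le_trans (ler_norm _))// normrN lerDr.
Qed.

Lemma finite_measure_quadrant_unique (m1 m2 : {measure set RR -> \bar R}) :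
  (m1 setT < +oo)%E ->
  (forall a b, m1 (quadrant a b) = m2 (quadrant a b)) ->
  forall A, measurable A -> m1 A = m2 A.
Proof.
move=> m1oo e; apply: (measure_unique quadrants (fun n => quadrant (- n%:R) (- n%:R))).
- exact: measurable_quadrantsE.
- exact: quadrants_setI.
- by move=> n; exists (- n%:R), (- n%:R).
- exact: quadrants_cover.
- by move=> _ [a [b ->]].
- move=> n; apply: (le_lt_trans _ m1oo); apply: le_measure; rewrite ?inE//.
  exact: measurable_quadrant.
Qed.

End QuadrantGenerator.

Lemma le_half_pow (R : realType) (C x : R) :
  (forall K, x <= C * 2^-1 ^+ K) -> x <= 0.
Proof.
move=> h; rewrite leNgt; apply/negP => x0.
(* For this [K] one has C / x < K < 2 ^ K, contradicting the hypothesis at [K]. *)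
pose K := (Num.truncn (C / x)).+1.
have := h K; rewrite leNgt => /negP; apply.
rewrite exprVn ltr_pdivrMr ?exprn_gt0// mulrC -ltr_pdivrMr//.
apply: (lt_le_trans (truncnS_gt _)); rewrite -natrX ler_nat.
exact/ltnW/ltn_expl.
Qed.

(** * Uniqueness of measures that charge the cells evenly *)

Section Fair.
Context {R : realType} (T : triangle R) (area : R).
Hypotheses (T_det : triangle_det T != 0) (area_gt0 : 0 < area).
Hypothesis T_area : lebesgue2 R (closed_triangle T) = area%:E.
Local Notation RR := (measurableTypeR R * measurableTypeR R)%type.
Local Notation S u := (closed_triangle (subtriangle T u)).

Definition inside_count (K : nat) (Q : set RR) : nat :=
  #|[pred c : K.-tuple 'I_4 | `[< S c `<=` Q >] ]|.

(* Only a lower bound is required: applied to [Q] and to its complement it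
   brackets [m Q] between two values that differ by the proportion of cells
   meeting the boundary of [Q]. *)
Definition fair (m : set RR -> \bar R) (t : R) :=
  forall K Q, measurable Q ->
    (((inside_count K Q)%:R * (t / 4 ^+ K))%:E <= m Q)%E.

Lemma card_words K : #|{: K.-tuple 'I_4}| = (4 ^ K)%N.
Proof. by rewrite card_tuple card_ord. Qed.

Lemma area_subtriangle K (c : K.-tuple 'I_4) :
  lebesgue2 R (S c) = (area / 4 ^+ K)%:E.
Proof.
by rewrite lebesgue2_subtriangle// T_area -EFinM size_tuple exprVn mulrC.
Qed.

(** The cells not contained in [Q] cover the rest of [T], and subadditivity bounds their union by
    the sum of their areas. Subtracting this from the whole area leaves the share of the inside
    cells; overlaps only help. *)
Lemma fair_lebesgue : fair (fun Q => lebesgue2 R (Q `&` closed_triangle T)) area.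
Proof.
move=> K Q mQ.
have mT := measurable_triangle T_det.
pose p (c : K.-tuple 'I_4) := ~~ `[< S c `<=` Q >].
pose V : set RR := [set x | exists c : K.-tuple 'I_4, p c /\ S c x].
have mS (c : K.-tuple 'I_4) : measurable (S c : set RR) by exact: measurable_subtriangle.
have mV : measurable V by exact: measurable_exists.
have cover : closed_triangle T `<=` (Q `&` closed_triangle T) `|` V.
  move=> x Tx; have [c cx] := subtriangle_cover K Tx.
  have [pc|pc] := boolP (p c); first by right; exists c.
  by left; split=> //; move: pc; rewrite negbK => /asboolP; apply.
have mQT : measurable (Q `&` closed_triangle T) by exact: measurableI.
have : (area%:E <= lebesgue2 R (Q `&` closed_triangle T) +
   ((4 ^ K - inside_count K Q)%N%:R * (area / 4 ^+ K))%:E)%E.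
  rewrite -T_area; apply: (@le_trans _ _ (lebesgue2 R ((Q `&` closed_triangle T) `|` V))).
    by apply: le_measure; rewrite ?inE//; exact: measurableU.
  apply: (le_trans (measureU2 _ mQT mV)); apply: leeD => //.
  apply: (le_trans (measure_exists_le _ _ mS)).
  rewrite (eq_bigr (fun=> (area / 4 ^+ K)%:E)); last by move=> c _; exact: area_subtriangle.
  rewrite sumEFin sumr_const lee_fin -[_ *+ #|p|]mulr_natl ler_wpM2r//.
    by rewrite divr_ge0// ?exprn_ge0// ltW.
  rewrite ler_nat leq_subRL -card_words; last exact: max_card.
  rewrite /inside_count.
  have <- := cardC [pred c : K.-tuple 'I_4 | `[< S c `<=` Q >] ].
  by rewrite leq_add2l; apply: eq_leq; apply: eq_card => c; rewrite !inE.
rewrite natrB; last by rewrite -card_words; exact: max_card.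
rewrite mulrBl natrX mulrCA mulfV ?mulr1 ?expf_neq0//.
(* Finiteness of this measure has not been established here; the infinite case is trivial. *)
case: (lebesgue2 R _) (measure_ge0 (@lebesgue_measure R \x @lebesgue_measure R)%E (Q `&` closed_triangle T)) => [r||]//.
  by rewrite -EFinD !lee_fin => _ h; lra.
by move=> _ _; exact: leey.
Qed.

(** A neighbourhood of the two lines that carry the boundary of [quadrant a b]. If [e] bounds the
    coordinate differences within a cell, it contains every cell that meets both the quadrant and
    its complement. *)
Definition strips (a b e : R) : set RR :=
  [set x | `|x.1 - a| <= e \/ `|x.2 - b| <= e].

Lemma measurable_strips a b e : measurable (strips a b e).
Proof.
set W := strips a b e.
rewrite (_ : W = ((fun x : RR => `|x.1 - a| : measurableTypeR R) @^-1` `]-oo, e]) `|`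
   ((fun x : RR => `|x.2 - b| : measurableTypeR R) @^-1` `]-oo, e])).
  apply: measurableU; rewrite -[X in measurable X]setTI.
    have mf : measurable_fun setT (fun x : RR => `|x.1 - a| : measurableTypeR R).
      by apply: measurableT_comp => //; apply: measurable_funB.
    by apply: mf => //; exact: measurable_itv.
  have mf : measurable_fun setT (fun x : RR => `|x.2 - b| : measurableTypeR R).
    by apply: measurableT_comp => //; apply: measurable_funB.
  by apply: mf => //; exact: measurable_itv.
by apply/seteqP; split=> x; rewrite /W /strips /= !in_itv.
Qed.

(** Each strip meets [T] inside a rectangle with sides 2e and 2 [triangle_radius T]; two such
    rectangles give the factor 8. *)
Lemma strips_measure a b e : 0 <= e ->
  (lebesgue2 R (strips a b e `&` closed_triangle T)
   <= (8 * triangle_radius T * e)%:E)%E.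
Proof.
move=> e0; set W := strips a b e.
pose M := triangle_radius T.
have M0 : 0 <= M := triangle_radius_ge0 T.
pose I (a b : R) : set (measurableTypeR R) := `[a, b]%classic.
have mI u v : measurable (I u v) by exact: measurable_itv.
have lI u v : u <= v -> lebesgue_measure (I u v) = (v - u)%:E.
  move=> uv; rewrite /I lebesgue_measure_itv /= lte_fin -EFinB.
  by case: ltgtP uv => // ->; rewrite subrr.
pose V1 : set RR := I (a - e) (a + e) `*` I (- M) M.
pose V2 : set RR := I (- M) M `*` I (b - e) (b + e).
have mV1 : measurable V1 by exact: measurableX.
have mV2 : measurable V2 by exact: measurableX.
have WV : W `&` closed_triangle T `<=` V1 `|` V2.
  move=> x [We /triangle_bound[]]; rewrite !ler_norml => x1 x2.
  case: We; rewrite ler_norml => h; [left|right]; rewrite /V1 /V2 /I;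
    split; rewrite /= !in_itv //=; lra.
have mW : measurable (W : set RR) by exact: measurable_strips.
have mT := measurable_triangle T_det.
apply: (@le_trans _ _ (lebesgue2 R (V1 `|` V2))).
  by apply: le_measure; rewrite ?inE//; [exact: measurableI|exact: measurableU].
have l1 : lebesgue2 R V1 = (2 * e * (2 * M))%:E.
  by rewrite lebesgue2_setX// !lI; [rewrite -EFinM; congr (_%:E); ring|lra|lra].
have l2 : lebesgue2 R V2 = (2 * e * (2 * M))%:E.
  by rewrite lebesgue2_setX// !lI; [rewrite -EFinM; congr (_%:E); ring|lra|lra].
apply: (@le_trans _ _ (lebesgue2 R V1 + lebesgue2 R V2)%E); first exact: measureU2.
by rewrite l1 l2 -EFinD lee_fin /M; lra.
Qed.

Lemma fair_unique (m1 m2 : {measure set RR -> \bar R}) (t : R) : 0 <= t ->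
  m1 setT = t%:E -> m2 setT = t%:E -> fair m1 t -> fair m2 t ->
  forall A, measurable A -> m1 A = m2 A.
Proof.
move=> t0 m1t m2t f1 f2; apply: finite_measure_quadrant_unique.
  by rewrite m1t ltry.
move=> a b; set Q := quadrant a b.
have mQ : measurable Q := measurable_quadrant a b.
have mQC : measurable (~` Q) by exact: measurableC.
have fin (m : {measure set RR -> \bar R}) A : m setT = t%:E -> measurable A ->
    m A \is a fin_num.
  move=> mt mA; rewrite ge0_fin_numE//.
  by apply: (@le_lt_trans _ _ (m setT)); [apply: le_measure; rewrite ?inE|rewrite mt ltry].
have bracket (m : {measure set RR -> \bar R}) K : m setT = t%:E -> fair m t ->
    (inside_count K Q)%:R * (t / 4 ^+ K) <= fine (m Q) <=
    t - (inside_count K (~` Q))%:R * (t / 4 ^+ K).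
  move=> mt fm; apply/andP; split.
    by rewrite -lee_fin fineK ?fin//; exact: fm.
  have : (m Q + m (~` Q) = t%:E)%E.
    by rewrite -measureU// ?setICr// setUv.
  have := fm K _ mQC; rewrite -(fineK (fin m _ mt mQC)) -(fineK (fin m _ mt mQ)).
  by rewrite lee_fin -EFinD => h [mQe]; lra.
pose M := triangle_radius T.
have M0 : 0 <= M := triangle_radius_ge0 T.
(* Cells in neither [Q] nor its complement lie in the strips. Fairness of Lebesgue measure itself,
   read as an upper bound on [inside_count], limits their number by area. *)
have straddle K : 4 ^+ K <= (inside_count K Q)%:R + (inside_count K (~` Q))%:R +
   8 * M * (2 * M * 2^-1 ^+ K) * 4 ^+ K / area.
  set e := 2 * M * 2^-1 ^+ K.
  have e0 : 0 <= e by rewrite !mulr_ge0// exprn_ge0// invr_ge0.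
  pose W := strips a b e.
  have cnt : (4 ^ K <= inside_count K Q + inside_count K (~` Q) + inside_count K W)%N.
    rewrite -card_words /inside_count.
    set A := [pred c | _]; set B := [pred c | _]; set C := [pred c | _].
    have sub c : (c \in {: K.-tuple 'I_4}) = (c \in [predU [predU A & B] & C]).
      rewrite !inE /=; apply/esym.
      have [//|/= nQ] := boolP `[< S c `<=` Q >].
      have [//|/= nQC] := boolP `[< S c `<=` ~` Q >].
      apply/asboolP => x cx.
      (* [y] outside [Q] and [z] inside it lie in the cell of [x]; the coordinate in which [y]
         violates the quadrant puts [x] within [e] of the corresponding line. *)
      move/asboolPn : nQ => /existsNP[y /not_implyP[cy nQy]].
      move/asboolPn : nQC => /existsNP[z /not_implyP[cz /contrapT Qz]].
      have [xy1 xy2] := subtriangle_diam cx cy.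
      have [xz1 xz2] := subtriangle_diam cx cz.
      move: xy1 xy2 xz1 xz2; rewrite size_tuple -/M -/e !ler_norml => xy1 xy2 xz1 xz2.
      case: Qz => z1 z2.
      have [ay|ya] := leP a y.1.
        right; rewrite ler_norml.
        have : y.2 < b by rewrite ltNge; apply/negP => yb; apply: nQy.
        by move=> yb; lra.
      by left; rewrite ler_norml; lra.
    have leU (p q : pred (K.-tuple 'I_4)) : (#|[predU p & q]| <= #|p| + #|q|)%N.
      by rewrite -cardUI leq_addr.
    by rewrite (eq_card sub) (leq_trans (leU _ _))// leq_add2r leU.
  have mW : measurable W by exact: measurable_strips.
  have := le_trans (fair_lebesgue K mW) (strips_measure a b e0).
  rewrite lee_fin -/M => wM.
  have : (inside_count K W)%:R <= 8 * M * e * 4 ^+ K / area.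
    rewrite ler_pdivlMr// -ler_pdivrMr ?exprn_gt0//.
    by rewrite -mulrA.
  by move=> wM'; apply: le_trans (lerD (lexx _) wM'); rewrite -natrX -!natrD ler_nat.
rewrite -(fineK (fin m1 _ m1t mQ)) -(fineK (fin m2 _ m2t mQ)); congr (_%:E).
apply/eqP; rewrite -subr_eq0 -normr_le0.
apply: (@le_half_pow _ (t * (8 * M * (2 * M)) / area)) => K.
have := bracket m1 K m1t f1; have := bracket m2 K m2t f2.
have := straddle K.
have p4 : 0 < 4 ^+ K :> R by rewrite exprn_gt0.
set n := (inside_count K Q)%:R; set n' := (inside_count K _)%:R.
move=> h /andP[b1 b2] /andP[b3 b4].
have : t - (n + n') * (t / 4 ^+ K) <= t * (8 * M * (2 * M)) / area * 2^-1 ^+ K.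
  rewrite (_ : t - _ = t / 4 ^+ K * (4 ^+ K - (n + n'))); last first.
    by field; rewrite gt_eqF.
  rewrite (_ : _ * 2^-1 ^+ K = t / 4 ^+ K * (8 * M * (2 * M * 2^-1 ^+ K) * 4 ^+ K / area)); last first.
    by field; rewrite !gt_eqF.
  apply: ler_wpM2l; first by rewrite divr_ge0// ltW.
  by rewrite lerBlDl.
by move=> h'; rewrite ler_norml; apply/andP; split; lra.
Qed.

End Fair.

(** * Limits of nested cells *)

Section NestedPoint.
Context {R : realType} (T : triangle R).
Hypothesis T_det : triangle_det T != 0.
Local Notation S u := (closed_triangle (subtriangle T u)).

Lemma closed_triangle_compact : compact (closed_triangle T).
Proof.
pose M := triangle_radius T.
apply: (@subclosed_compact _ _ (`[- M, M]%classic `*` `[- M, M]%classic)).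
- exact: closed_triangle_closed.
- by apply: compact_setX; exact: segment_compact.
- move=> x /triangle_bound[]; rewrite !ler_norml => x1 x2.
  by split; rewrite /= in_itv.
Qed.

Lemma mkseq_add (e : nat -> 'I_4) K L :
  mkseq e (K + L) = mkseq e K ++ mkseq (fun l => e (K + l)%N) L.
Proof.
rewrite /mkseq iotaD map_cat; congr (_ ++ _).
by rewrite add0n -[X in iota X]addn0 iotaDl -map_comp.
Qed.

(** The vertices [a K] eventually lie in every cell of the chain, so a cluster point, which exists
    by compactness, lies in all of these closed cells. *)
Lemma nested_point (e : nat -> 'I_4) : exists x, forall K, S (mkseq e K) x.
Proof.
pose a K := vA (subtriangle T (mkseq e K)).
have tail K L : (K <= L)%N -> S (mkseq e K) (a L).
  move=> /subnKC <-; rewrite /a mkseq_add subtriangle_cat.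
  by apply: subtriangle_subset; exact: triangle_vA.
have [|x [_ cx]] := closed_triangle_compact (F := a @ \oo) _.
  by exists 0%N => // L _; exact: (tail 0%N).
exists x => K; have := closed_subtriangle_closed (u := mkseq e K) T_det; apply.
move: cx; rewrite clusterE; apply.
by exists K => // L /= KL; exact: tail.
Qed.

(** Turns membership of a limit point in a quadrant into countably many conditions on finite words;
    measurability of the points rests on it. *)
Lemma subtriangle_quadrant_limit (u : nat -> seq 'I_4) (x : R * R) (a b : R) :
  (forall K, size (u K) = K) -> (forall K, S (u K) x) ->
  (forall K, exists y, S (u K) y /\ quadrant a b y) -> quadrant a b x.
Proof.
move=> su ux uy.
have near K : x.1 >= a - 2 * triangle_radius T * 2^-1 ^+ K /\
              x.2 >= b - 2 * triangle_radius T * 2^-1 ^+ K.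
  have [y [Sy [ay by_]]] := uy K.
  have [] := subtriangle_diam (ux K) Sy; rewrite su !ler_norml => h1 h2.
  by split; lra.
split; rewrite -subr_le0; apply: (@le_half_pow _ (2 * triangle_radius T)) => K;
  have [? ?] := near K; lra.
Qed.

End NestedPoint.

(** * Law of a point with evenly distributed digits *)

Section LimitPoint.
Context {R : realType} (T : triangle R) (area : R).
Hypotheses (T_det : triangle_det T != 0) (area_gt0 : 0 < area).
Hypothesis T_area : lebesgue2 R (closed_triangle T) = area%:E.
Context {d : measure_display} {Omega : measurableType d} (P : probability Omega R).
Local Notation RR := (measurableTypeR R * measurableTypeR R)%type.
Local Notation S u := (closed_triangle (subtriangle T u)).
Variables (D : forall K, Omega -> K.-tuple 'I_4) (Y : Omega -> RR).
Hypothesis D_measurable : forall K c, measurable (D K @^-1` [set c]).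

Lemma measurable_limit_point : (forall w K, S (D K w) (Y w)) -> measurable_fun setT Y.
Proof.
move=> SY; apply: (measurability _ measurable_quadrantsE) => _ [_ [a [b ->]] <-].
rewrite setTI.
pose p K (c : K.-tuple 'I_4) := `[< exists y, S c y /\ quadrant a b y >].
have -> : Y @^-1` quadrant a b =
    \bigcap_K [set w | exists c : K.-tuple 'I_4, p K c /\ (D K @^-1` [set c]) w].
  apply/seteqP; split=> w.
    by move=> Qw K _; exists (D K w); split=> //; apply/asboolP; exists (Y w).
  move=> Dw; apply: (@subtriangle_quadrant_limit _ T (fun K => D K w)) => [K|K|K].
  - by rewrite size_tuple.
  - exact: SY.
  - by have [c [/asboolP pc /= ->]] := Dw K I.
by apply: bigcapT_measurable => K; exact: measurable_exists.
Qed.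

(** Restricting [P] to [F] stands in for conditioning and avoids division; [t] is the mass of [F].
    The restricted law of [Y] and a multiple of area on [T] are both fair with parameter [t], so
    [fair_unique] applies. *)
Lemma limit_point_law (F : set Omega) (t : R) : measurable F -> measurable_fun setT Y ->
  (forall w K, F w -> S (D K w) (Y w)) ->
  (forall K (c : K.-tuple 'I_4), P (F `&` D K @^-1` [set c]) = (t / 4 ^+ K)%:E) ->
  forall B : set RR, measurable B ->
    P (F `&` Y @^-1` B) = ((t / area)%:E * lebesgue2 R (B `&` closed_triangle T))%E.
Proof.
move=> mF mY SY PD B mB.
have PF : P F = t%:E.
  have -> : F = F `&` D 0 @^-1` [set [tuple]].
    by apply/seteqP; split=> w; [move=> Fw; split=> //=; exact: tuple0|case].
  by rewrite PD expr0 divr1.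
have t0 : 0 <= t by rewrite -lee_fin -PF; exact: measure_ge0.
have mT : measurable (closed_triangle T : set RR) := measurable_triangle T_det.
pose m1' : {measure set RR -> \bar R} := pushforward (mrestr P mF) Y.
pose m1 := m1' mY.
have m1E Q : m1 Q = P (Y @^-1` Q `&` F) by [].
have ta0 : 0 <= t / area by rewrite divr_ge0// ltW.
pose m2 : {measure set RR -> \bar R} :=
  mscale (NngNum ta0) (mrestr (@lebesgue_measure R \x @lebesgue_measure R)%E mT).
have m2E Q : m2 Q = ((t / area)%:E * lebesgue2 R (Q `&` closed_triangle T))%E by [].
rewrite setIC -m1E -m2E; apply: (fair_unique T_det area_gt0 T_area t0) => //.
- by rewrite m1E preimage_setT setTI PF.
- by rewrite m2E setTI T_area -EFinM divfK// gt_eqF.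
- move=> K Q mQ; rewrite m1E.
  pose p (c : K.-tuple 'I_4) := `[< S c `<=` Q >].
  have <- : P (F `&` [set w | p (D K w)]) = ((inside_count T K Q)%:R * (t / 4 ^+ K))%:E.
    rewrite (measure_fiber_sum _ _ mF (@D_measurable K)) (eq_bigr (fun=> (t / 4 ^+ K)%:E)); last by move=> c _; exact: PD.
    by rewrite sumEFin sumr_const -[_ *+ #|_|]mulr_natl.
  apply: le_measure; rewrite ?inE.
  - apply: measurableI => //.
    rewrite (_ : [set w | _] = [set w | exists c, p c /\ (D K @^-1` [set c]) w]).
      by apply: measurable_exists => c; exact: D_measurable.
    apply/seteqP; split=> w; first by move=> pw; exists (D K w).
    by move=> [c [pc /= Dc]]; rewrite Dc.
  - apply: measurableI => //.
    by rewrite -[X in measurable X]setTI; exact: (mY measurableT Q mQ).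
  - move=> w [Fw /asboolP pw]; split=> //; apply: pw.
    exact: SY.
- move=> K Q mQ; rewrite m2E.
  have := fair_lebesgue T_det area_gt0 T_area K mQ.
  move=> h; apply: (@le_trans _ _ ((t / area)%:E * ((inside_count T K Q)%:R * (area / 4 ^+ K))%:E)%E).
    rewrite -EFinM lee_fin le_eqVlt; apply/orP; left; apply/eqP; field.
    by rewrite !gt_eqF// exprn_gt0.
  by apply: lee_wpmul2l => //; rewrite lee_fin.
Qed.

End LimitPoint.

(** * Base 4 digits, least significant first *)

Section Digits.

Lemma digits_cons n K : digits n K.+1 = digit n 0 :: digits (n %/ 4) K.
Proof.
rewrite /digits /mkseq /=; congr (_ :: _); rewrite -[X in iota X](addn0 1%N) iotaDl -map_comp.
by apply: eq_map => j /=; rewrite /digit add1n expnS divnMA.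
Qed.

Lemma digits_inj k n m : (n < 4 ^ k)%N -> (m < 4 ^ k)%N ->
  digits n k = digits m k -> n = m.
Proof.
elim: k n m => [|k IH] n m nk mk; first by case: n m nk mk => [|?] [|?].
rewrite !digits_cons => -[e0 e].
have e1 : (n %/ 4 = m %/ 4)%N.
  by apply: IH e; rewrite ltn_divLR// -expnSr.
have := congr1 (@nat_of_ord 4) e0; rewrite /digit expn0 !divn1 !inordK ?ltn_pmod// => e2.
by rewrite (divn_eq n 4) (divn_eq m 4) e1 e2.
Qed.

Lemma size_digits n K : size (digits n K) = K.
Proof. exact: size_mkseq. Qed.

Lemma take_digits n k j : (k <= j)%N -> take k (digits n j) = digits n k.
Proof. by move=> kj; rewrite /digits /mkseq -map_take take_iota (minn_idPl kj). Qed.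

Lemma eq_mkseqP (X : Type) (f g : nat -> X) K :
  mkseq f K = mkseq g K -> forall j, (j < K)%N -> f j = g j.
Proof. by move=> e j jK; have := congr1 (fun s => nth (f 0%N) s j) e; rewrite !nth_mkseq. Qed.

End Digits.

(** * Finite prescriptions of permutation values *)

Section Constraints.
Context d (Omega : measurableType d) {R : realType} (P : probability Omega R)
  (pi : seq 'I_4 -> Omega -> {perm 'I_4}).
Hypothesis pi_scrambling : nested_uniform_scrambling P pi.

(* [(v, (a, b))] stands for the requirement that [pi v] sends [a] to [b]. *)
Local Notation constraint := (seq 'I_4 * ('I_4 * 'I_4))%type.
Implicit Types (Cs : seq constraint) (F : set Omega).

Definition satisfied Cs : set Omega :=
  [set w | forall c, c \in Cs -> pi c.1 w c.2.1 = c.2.2].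

Lemma measurable_pi v (B : set {perm 'I_4}) : measurable (pi v @^-1` B).
Proof. by have [[+ _] _] := pi_scrambling; apply. Qed.

Lemma satisfied_cat Cs Cs' : satisfied (Cs ++ Cs') = satisfied Cs `&` satisfied Cs'.
Proof.
apply/seteqP; split=> w.
  by move=> h; split=> c cC; apply: h; rewrite mem_cat cC ?orbT.
by move=> [h1 h2] c; rewrite mem_cat => /orP[/h1|/h2].
Qed.

Lemma satisfied_nil : satisfied [::] = setT.
Proof. by apply/seteqP; split. Qed.

Lemma satisfied_cons c Cs :
  satisfied (c :: Cs) = (pi c.1 @^-1` [set s | s c.2.1 = c.2.2]) `&` satisfied Cs.
Proof.
rewrite -cat1s satisfied_cat; congr (_ `&` _); apply/seteqP; split=> w /=.
  by apply; rewrite mem_head.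
by move=> h c'; rewrite inE => /eqP ->.
Qed.

Lemma measurable_satisfied Cs : measurable (satisfied Cs).
Proof.
elim: Cs => [|c Cs IH]; first by rewrite satisfied_nil.
by rewrite satisfied_cons; apply: measurableI => //; exact: measurable_pi.
Qed.

(** Mutual independence offers one event per word, so the constraints that share a word are merged
    into one event. *)
Lemma satisfiedE Cs : satisfied Cs =
  \bigcap_(v in [set` undup (map fst Cs)])
    (pi v @^-1` [set s | forall c, c \in Cs -> c.1 = v -> s c.2.1 = c.2.2]).
Proof.
apply/seteqP; split=> w.
  by move=> h v _ c cC <-; exact: h.
move=> h c cC; apply: (h c.1) => //=.
by rewrite mem_undup map_f.
Qed.

(** Composition with the transposition of [b1] and [b2] is a bijection, so the four values of [s a]
    are taken by equally many permutations, a quarter of all. *)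
Lemma prob_pi v a b : P (pi v @^-1` [set s | s a = b]) = (4^-1)%:E.
Proof.
pose n b' := #|[pred s : {perm 'I_4} | s a == b']|.
have Pn b' : P (pi v @^-1` [set s | s a = b']) = ((n b')%:R / (4`!)%:R)%:E.
  have := measure_fiber_sum P [pred s : {perm 'I_4} | s a == b'] (@measurableT _ Omega)
    (fun s => measurable_pi v [set s]).
  rewrite setTI => e.
  rewrite (_ : pi v @^-1` _ = [set x | [pred s : {perm 'I_4} | s a == b'] (pi v x)]); last first.
    by apply/seteqP; split=> w /= /eqP.
  rewrite e (eq_bigr (fun=> (4`!%:R^-1)%:E)); last first.
    by move=> s _; rewrite setTI; have [_ h] := pi_scrambling; exact: h.
  by rewrite sumEFin sumr_const -[_ *+ #|_|]mulr_natl.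
have neq b1 b2 : n b1 = n b2.
  rewrite /n -(card_imset _ (mulIg (tperm b1 b2))).
  apply: eq_card => s; rewrite inE; apply/imsetP/idP => [[s' /eqP s'a ->]|/eqP sa].
    by rewrite permM s'a tpermL.
  exists (s * tperm b1 b2)%g; last by rewrite -mulgA tperm2 mulg1.
  by rewrite inE permM sa tpermR.
have n4 : (n b * 4 = 4`!)%N.
  have <- : #|{perm 'I_4}| = 4`!%N by rewrite card_Sn.
  rewrite -sum1_card (partition_big (fun s : {perm 'I_4} => s a) predT)//=.
  rewrite (eq_bigr (fun=> n b)) => [|b' _]; first by rewrite sum_nat_const card_ord mulnC.
  by rewrite (neq b b') /n -sum1_card; apply: eq_bigl => s; rewrite !inE.
rewrite Pn -n4 natrM; congr (_%:E).
have : (n b)%:R != 0 :> R by rewrite pnatr_eq0; case: (n b) n4.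
by move=> nb0; field.
Qed.

Lemma prob_satisfied_cons v a b Cs : v \notin map fst Cs ->
  P (satisfied ((v, (a, b)) :: Cs)) = (4^-1%:E * P (satisfied Cs))%E.
Proof.
move=> vC; have [[_ indep] _] := pi_scrambling.
pose B u := [set s : {perm 'I_4} | forall c, c \in Cs -> c.1 = u -> s c.2.1 = c.2.2].
pose B' u := if u == v then [set s : {perm 'I_4} | s a = b] else B u.
have vJ : v \notin undup (map fst Cs) by rewrite mem_undup.
have uJ : uniq (v :: undup (map fst Cs)) by rewrite /= vJ undup_uniq.
have B'B u : u \in undup (map fst Cs) -> B' u = B u.
  by rewrite /B'; case: eqP => // ->; rewrite (negbTE vJ).
have -> : satisfied ((v, (a, b)) :: Cs) =
    \bigcap_(u in [set` v :: undup (map fst Cs)]) (pi u @^-1` B' u).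
  rewrite satisfied_cons satisfiedE; apply/seteqP; split=> w.
    move=> [h1 h2] u /=; rewrite inE => /orP[/eqP ->|uC]; first by rewrite /B' eqxx.
    by rewrite B'B//; exact: h2.
  move=> h; split; first by have := h v; rewrite /= mem_head /B' eqxx; apply.
  by move=> u uC; have := h u; rewrite /= inE uC orbT B'B//; apply.
rewrite indep// big_cons satisfiedE indep ?undup_uniq//.
rewrite {1}/B' eqxx prob_pi; congr (_ * _)%E.
by apply: eq_big_seq => u uC; rewrite B'B.
Qed.

(** [V] holds the words whose permutations [F] may depend on. Testing at most one value per word
    keeps the right side an explicit power of 1/4, and suffices for reading the digits of a single
    index, whose prefixes are distinct. *)
Definition independent_off (V : pred (seq 'I_4)) F :=
  measurable F /\ forall Cs, uniq (map fst Cs) -> (forall c, c \in Cs -> ~~ V c.1) ->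
    P (F `&` satisfied Cs) = (P F * (4^-1 ^+ size Cs)%:E)%E.

(** The words in [Cs] may repeat. The new words are distinct and fresh, so they are peeled off one
    by one, each for a factor 1/4. *)
Lemma independent_off_satisfied (V : pred (seq 'I_4)) Cs :
  (forall c, c \in Cs -> V c.1) -> independent_off V (satisfied Cs).
Proof.
move=> VC; split; first exact: measurable_satisfied.
elim=> [|[v [a b]] Cs' IH] /=; first by rewrite satisfied_nil setIT expr0 mule1.
move=> /andP[vC uC] VC'.
rewrite setIC -satisfied_cat /= prob_satisfied_cons.
  rewrite satisfied_cat setIC IH//; last by move=> c cC; apply: VC'; rewrite inE cC orbT.
  by rewrite muleCA -EFinM -exprS.
rewrite map_cat mem_cat negb_or vC /=; apply/mapP => -[c cC vE].
by have := VC' _ (mem_head _ _); rewrite /= vE VC.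
Qed.

End Constraints.

Lemma subtriangle_det_neq0 (R : realType) (T : triangle R) u :
  triangle_det T != 0 -> triangle_det (subtriangle T u) != 0.
Proof.
have [r [z [rE aE bE cE]]] := subtriangle_homothety T u.
have r0 : r != 0 by rewrite -normr_gt0 rE exprn_gt0// invr_gt0.
have -> : triangle_det (subtriangle T u) = r ^+ 2 * triangle_det T.
  by rewrite /triangle_det aE bE cE /= /GRing.scale /=; ring.
by move=> d0; rewrite mulf_neq0// sqrf_eq0.
Qed.

(** * Scrambled points: cells, measurability and independence *)

Section ScrambledPoints.
Context {R : realType} (T : triangle R).
Hypothesis T_det : triangle_det T != 0.
Hypothesis T_area : lebesgue2 R (closed_triangle T) = 1%E.
Context {d : measure_display} {Omega : measurableType d} (P : probability Omega R).
Variable pi : seq 'I_4 -> Omega -> {perm 'I_4}.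
Hypothesis pi_scrambling : nested_uniform_scrambling P pi.
Local Notation RR := (measurableTypeR R * measurableTypeR R)%type.
Local Notation S u := (closed_triangle (subtriangle T u)).
Local Notation point n := (scrambled_point T pi n.+1 : Omega -> RR).
Local Notation scrambled K n w := (scrambled_digits pi K n.+1 w).

(** The permutation applied at place [j] depends only on the earlier digits. Once these agree for
    [n] and [m], equal outputs force equal digits at [j]. *)
Lemma scrambled_digits_inj k n m w : (n < 4 ^ k)%N -> (m < 4 ^ k)%N ->
  scrambled k n w = scrambled k m w -> n = m.
Proof.
move=> nk mk /eq_mkseqP /= e; apply: (digits_inj nk mk).
have : (k <= k)%N by []; elim: {-2}k => [//|j IH] jk.
have ej := IH (ltnW jk); have := e j jk; rewrite ej => /perm_inj dj.
by rewrite /digits !mkseqS -!/(digits _ j) ej dj.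
Qed.

Lemma scrambled_digits_bij k w (e : k.-tuple 'I_4) :
  exists! i : 'I_(4 ^ k), scrambled k i w = e.
Proof.
pose f (i : 'I_(4 ^ k)) : k.-tuple 'I_4 :=
  [tuple of mkseq (fun j => pi (digits i j) w (digit i j)) k].
have finj : injective f.
  move=> i j /(congr1 val) /= fij; apply: val_inj.
  exact: (scrambled_digits_inj (ltn_ord i) (ltn_ord j) fij).
have [g fg gf] : bijective f.
  by apply: inj_card_bij => //; rewrite card_words card_ord.
exists (g e); split; first by have := congr1 val (gf e).
by move=> i fi; apply: finj; rewrite gf; exact/esym/val_inj.
Qed.

Lemma scrambled_point_in n K w : S (scrambled K n w) (point n w).
Proof.
have [x xP] := nested_point T_det (fun j => pi (digits n j) w (digit n j)).
have pointP L : (1 <= L)%N -> S (scrambled L n w) (point n w).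
  (* [get] yields a default value unless the intersection is inhabited, which the nested point
     guarantees. *)
  have ex : exists y, (\bigcap_(K in [set K | (1 <= K)%N]) S (scrambled K n w)) y.
    by exists x => L' _; exact: xP.
  by move=> L1; have := getPex ex; apply.
(* The intersection starts at [K = 1]; level 0 follows because the level 1 cell lies in [T]. *)
case: K => [|K]; last exact: pointP.
exact: subtriangle_subset (pointP 1%N isT).
Qed.

Definition tail_digits n k K w : K.-tuple 'I_4 :=
  [tuple of mkseq (fun l => pi (digits n (k + l)) w (digit n (k + l))) K].

Lemma scrambled_digits_add n k K w :
  scrambled (k + K) n w = scrambled k n w ++ tail_digits n k K w.
Proof. exact: mkseq_add. Qed.

Definition digit_constraints n k (c : seq 'I_4) :=
  mkseq (fun l => (digits n (k + l), (digit n (k + l), nth ord0 c l))) (size c).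

Lemma satisfied_digit_constraints n k c :
  satisfied pi (digit_constraints n k c) =
  [set w | mkseq (fun l => pi (digits n (k + l)) w (digit n (k + l))) (size c) = c].
Proof.
apply/seteqP; split=> w /=.
  move=> h; apply: (@eq_from_nth _ ord0); rewrite size_mkseq// => l lc.
  rewrite nth_mkseq//.
  by apply: (h (digits n (k + l), (digit n (k + l), nth ord0 c l))); apply/mapP; exists l => //; rewrite mem_iota.
move=> e _ /mapP[l + ->] /=; rewrite mem_iota /= add0n => lc.
by have := congr1 (fun t => nth ord0 t l) e; rewrite nth_mkseq.
Qed.

Lemma tail_digits_fiber n k K (c : K.-tuple 'I_4) :
  tail_digits n k K @^-1` [set c] = satisfied pi (digit_constraints n k c).
Proof.
rewrite satisfied_digit_constraints size_tuple.
by apply/seteqP; split=> w /=; [move=> /(congr1 val)|move=> h; exact: val_inj].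
Qed.

Lemma uniq_digit_constraints n k c : uniq (map fst (digit_constraints n k c)).
Proof.
rewrite -map_comp map_inj_uniq ?iota_uniq// => i j /(congr1 size).
by rewrite /= !size_digits => /addnI.
Qed.

Lemma measurable_tail_digits n k K (c : K.-tuple 'I_4) :
  measurable (tail_digits n k K @^-1` [set c]).
Proof. by rewrite tail_digits_fiber; exact: (measurable_satisfied pi_scrambling). Qed.

Lemma measurable_scrambled_point n : measurable_fun setT (point n).
Proof.
apply: (@measurable_limit_point _ T _ _ (fun K => tail_digits n 0 K)).
  exact: measurable_tail_digits.
by move=> w K; exact: scrambled_point_in.
Qed.

(* The words whose permutations produce the digits of the point [n] after the
   first [k]; for distinct [n < 4 ^ k] these sets of words are disjoint. *)
Definition tail_word n k : pred (seq 'I_4) :=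
  fun u => (k <= size u)%N && (u == digits n (size u)).

Lemma tail_word_digits n k l : tail_word n k (digits n (k + l)).
Proof. by rewrite /tail_word size_digits leq_addr eqxx. Qed.

Lemma tail_word_disjoint k n m l : (n < 4 ^ k)%N -> (m < 4 ^ k)%N -> n != m ->
  ~~ tail_word n k (digits m (k + l)).
Proof.
move=> nk mk; apply: contra => /andP[_ /eqP]; rewrite size_digits.
move=> /(congr1 (take k)); rewrite !take_digits ?leq_addr// => e.
by apply/eqP/esym/(digits_inj mk nk).
Qed.

(** * Adding the position of one point to an event *)

Section OnePoint.
Variables (V : pred (seq 'I_4)) (F : set Omega) (n k : nat) (s : seq 'I_4).
Hypotheses (F_indep : independent_off P pi V F) (size_s : size s = k).
Hypothesis V_fresh : forall l, ~~ V (digits n (k + l)).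
Hypothesis F_digits : forall w, F w -> scrambled k n w = s.

Lemma independent_off_tail Cs :
  uniq (map fst Cs) -> (forall c, c \in Cs -> ~~ (V c.1 || tail_word n k c.1)) ->
  forall K (c : K.-tuple 'I_4),
  P ((F `&` satisfied pi Cs) `&` tail_digits n k K @^-1` [set c]) =
  (P (F `&` satisfied pi Cs) * (4^-1 ^+ K)%:E)%E.
Proof.
move=> uC VC K c.
have VC' c' : c' \in Cs -> ~~ V c'.1 by move/VC; rewrite negb_or => /andP[].
rewrite tail_digits_fiber -setIA -satisfied_cat F_indep.2.
- by rewrite F_indep.2// size_cat size_mkseq size_tuple exprD EFinM muleA.
- rewrite map_cat cat_uniq uC uniq_digit_constraints andbT /=.
  apply/hasPn => _ /mapP[_ /mapP[l _ ->] ->] /=; apply/mapP => -[c' c'C e].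
  by have := VC _ c'C; rewrite -e tail_word_digits orbT.
- move=> c'; rewrite mem_cat => /orP[/VC'//|/mapP[l _ ->]]; exact: V_fresh.
Qed.

(** [limit_point_law] is applied inside the cell [S s], of area 4^-k, with the joint mass of [F] and
    the constraints as [t]. Carrying arbitrary [Cs] through is what later yields independence from
    the remaining permutations. *)
Lemma prob_point_cond Cs (B : set RR) : measurable B ->
  uniq (map fst Cs) -> (forall c, c \in Cs -> ~~ (V c.1 || tail_word n k c.1)) ->
  P ((F `&` satisfied pi Cs) `&` point n @^-1` B) =
  (P (F `&` satisfied pi Cs) * ((4 ^+ k)%:E * lebesgue2 R (B `&` S s)))%E.
Proof.
move=> mB uC VC.
have mF : measurable (F `&` satisfied pi Cs).
  by apply: measurableI; [exact: F_indep.1|exact: (measurable_satisfied pi_scrambling)].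
have fin : P (F `&` satisfied pi Cs) \is a fin_num by exact: fin_num_measure.
have a0 : 0 < 4^-1 ^+ k :> R by rewrite exprn_gt0// invr_gt0.
rewrite (@limit_point_law _ (subtriangle T s) (4^-1 ^+ k) _ a0 _ _ _ _
   (fun K => tail_digits n k K) _ _ _ (fine (P (F `&` satisfied pi Cs)))) //.
- by rewrite EFinM fineK// -muleA exprVn invrK.
- exact: subtriangle_det_neq0.
- by rewrite lebesgue2_subtriangle// T_area mule1 size_s.
- by move=> K c; exact: measurable_tail_digits.
- exact: measurable_scrambled_point.
- move=> w K [Fw _]; rewrite -subtriangle_cat -(F_digits Fw) -scrambled_digits_add.
  exact: scrambled_point_in.
- by move=> K c; rewrite independent_off_tail// EFinM fineK// exprVn.
Qed.

(** The induction step over points: [prob_point_cond] without constraints gives the probability, and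
    with constraints it gives the independence of the enlarged event from the permutations at all
    remaining words. *)
Lemma independent_off_point (B : set RR) : measurable B ->
  P (F `&` point n @^-1` B) = (P F * ((4 ^+ k)%:E * lebesgue2 R (B `&` S s)))%E /\
  independent_off P pi [predU V & tail_word n k] (F `&` point n @^-1` B).
Proof.
move=> mB.
have PB : P (F `&` point n @^-1` B) = (P F * ((4 ^+ k)%:E * lebesgue2 R (B `&` S s)))%E.
  have := @prob_point_cond [::] B mB isT.
  by rewrite satisfied_nil setIT; apply.
split=> //; split.
  apply: measurableI; first exact: F_indep.1.
  by rewrite -[X in measurable X]setTI; exact: (@measurable_scrambled_point n measurableT B mB).
move=> Cs uC VC; rewrite setIAC prob_point_cond// PB.
rewrite F_indep.2//; first by rewrite muleAC.
by move=> c /VC; rewrite negb_or => /andP[].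
Qed.

End OnePoint.

(** * The joint law given the assignment of cells *)

Section Assignment.
Variables (k : nat) (s : 'I_(4 ^ k) -> seq 'I_4).

Definition assignment : set Omega :=
  [set w | forall i : 'I_(4 ^ k), scrambled k i w = s i].

(** Words may repeat here, since indices with a common prefix share permutations. The probability of
    an assignment is therefore left unevaluated; it may be zero. *)
Definition assignment_constraints :=
  [seq (digits i j, (digit i j, nth ord0 (s i) j)) | i : 'I_(4 ^ k) <- enum 'I_(4 ^ k),
                                                  j <- iota 0 k].

Hypothesis size_s : forall i, size (s i) = k.

Lemma assignmentE : assignment = satisfied pi assignment_constraints.
Proof.
apply/seteqP; split=> w.
  move=> h _ /allpairsP[[i j] /= [_ jk ->]] /=.
  move: jk; rewrite mem_iota /= add0n => jk.
  have := congr1 (fun t => nth ord0 t j) (h i).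
  by rewrite /scrambled_digits nth_mkseq.
move=> h i; apply: (@eq_from_nth _ ord0); first by rewrite size_mkseq size_s.
rewrite size_mkseq => j jk; rewrite nth_mkseq//=.
apply: (h (digits i j, (digit i j, nth ord0 (s i) j))).
apply/allpairsP; exists (i, j); split=> //=; first by rewrite mem_enum.
by rewrite mem_iota.
Qed.

Lemma independent_off_assignment :
  independent_off P pi [pred u | (size u < k)%N] assignment.
Proof.
rewrite assignmentE; apply: (independent_off_satisfied pi_scrambling) => c.
move=> /allpairsP[[i j] /= [_ jk ->]] /=.
by rewrite size_digits; move: jk; rewrite mem_iota.
Qed.

(** Both conclusions go through one induction: adding [i] to [J] needs the event for [J] to be
    independent of the permutations at the tail words of [i]. *)
Lemma assignment_joint_law (J : seq 'I_(4 ^ k)) (B : 'I_(4 ^ k) -> set RR) :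
  uniq J -> (forall i, measurable (B i)) ->
  P (assignment `&` \bigcap_(i in [set` J]) (point i @^-1` B i)) =
    (P assignment * \prod_(i <- J) ((4 ^+ k)%:E * lebesgue2 R (B i `&` S (s i))))%E /\
  independent_off P pi
    [pred u | (size u < k)%N || has (fun i : 'I_(4 ^ k) => tail_word i k u) J]
    (assignment `&` \bigcap_(i in [set` J]) (point i @^-1` B i)).
Proof.
move=> + mB; elim: J => [|i J IH] /=.
  move=> _; rewrite bigcap_seq !big_nil setIT mule1; split=> //.
  have [mE hE] := independent_off_assignment.
  split=> // Cs uC hC; apply: hE => // c /hC.
  by rewrite /= orbF.
move=> /andP[iJ uJ]; have [PJ indJ] := IH uJ.
have -> : assignment `&` \bigcap_(j in [set` i :: J]) (point j @^-1` B j) =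
  (assignment `&` \bigcap_(j in [set` J]) (point j @^-1` B j)) `&` point i @^-1` B i.
  by rewrite !bigcap_seq big_cons [X in _ `&` X]setIC setIA.
have fresh l : ~~ ([pred u | (size u < k)%N || has (fun i : 'I_(4 ^ k) => tail_word i k u) J] (digits i (k + l))).
  rewrite /= size_digits ltnNge leq_addr /=; apply/hasPn => j jJ.
  apply: tail_word_disjoint => //; apply/eqP => ji.
  by move: iJ; rewrite -(val_inj ji) jJ.
have [PiJ indiJ] := independent_off_point indJ (size_s i) fresh (fun w h => h.1 i) (mB i).
split; first by rewrite PiJ PJ big_cons -muleA [in RHS](muleC (_ * lebesgue2 _ _)%E).
case: indiJ => mI hI; split=> // Cs uC hC; apply: hI => // c /hC.
by apply: contra => /=; rewrite -!orbA [has _ _ || _]orbC.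
Qed.

End Assignment.

Lemma conditional_law k (s : 'I_(4 ^ k) -> seq 'I_4) :
  (0 < P (assignment s))%E ->
  mutually_independent (@measurable _ RR) (conditional P (assignment s))
    (fun i : 'I_(4 ^ k) => point i) /\
  forall i : 'I_(4 ^ k),
    uniform_on (S (s i)) (conditional P (assignment s)) (point i).
Proof.
move=> E0.
(* An event of positive probability contains an outcome, which realises [s], so its words have
   length [k]. *)
have size_s i : size (s i) = k.
  have [w Ew] : assignment s !=set0.
    by apply/set0P; apply: contraTneq E0 => ->; rewrite measure0 ltxx.
  by rewrite -(Ew i) size_mkseq.
have Efin : P (assignment s) \is a fin_num.
  by apply: fin_num_measure; have [] := independent_off_assignment size_s.
have [e [e0 PE]] : exists e : R, 0 < e /\ P (assignment s) = e%:E.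
  exists (fine (P (assignment s))); rewrite fineK//; split=> //.
  by rewrite -lte_fin fineK.
have joint (J : seq 'I_(4 ^ k)) (B : 'I_(4 ^ k) -> set RR) : uniq J ->
    (forall i, measurable (B i)) ->
    conditional P (assignment s) (\bigcap_(i in [set` J]) (point i @^-1` B i)) =
    (\prod_(i <- J) ((4 ^+ k)%:E * lebesgue2 R (B i `&` S (s i))))%E.
  move=> uJ mB; rewrite /conditional setIC (assignment_joint_law size_s uJ mB).1 PE.
  have [p ->] : exists p : R, (\prod_(i <- J) ((4 ^+ k)%:E * lebesgue2 R (B i `&` S (s i))))%E = p%:E.
    elim: J {uJ} => [|i J [p pE]]; first by exists 1; rewrite big_nil.
    have Bfin : lebesgue2 R (B i `&` S (s i)) \is a fin_num.
      rewrite ge0_fin_numE; last exact: measure_ge0.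
      apply: (@le_lt_trans _ _ (lebesgue2 R (S (s i)))).
        apply: le_measure; rewrite ?inE//; last exact: measurable_subtriangle.
        by apply: measurableI => //; exact: measurable_subtriangle.
      by rewrite lebesgue2_subtriangle// T_area mule1 ltry.
    exists (4 ^+ k * fine (lebesgue2 R (B i `&` S (s i))) * p).
    by rewrite big_cons pE !EFinM fineK.
  rewrite inver (gt_eqF e0) -!EFinM; congr (_%:E); field.
  by rewrite gt_eqF.
have marginal (i : 'I_(4 ^ k)) (B : set RR) : measurable B ->
    conditional P (assignment s) (point i @^-1` B) =
    ((4 ^+ k)%:E * lebesgue2 R (B `&` S (s i)))%E.
  move=> mB; have := joint [:: i] (fun=> B) isT (fun=> mB).
  by rewrite big_seq1 bigcap_seq big_seq1.
split; last first.
  move=> i B mB; rewrite marginal// lebesgue2_subtriangle// T_area mule1 size_s.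
  rewrite inver gt_eqF ?exprn_gt0 ?invr_gt0//= exprVn invrK.
  by rewrite muleC.
split=> [i B mB|J B uJ mB].
  by rewrite -[X in measurable X]setTI; exact: (@measurable_scrambled_point i measurableT B mB).
by rewrite joint//; apply: eq_bigr => i _; rewrite marginal.
Qed.

End ScrambledPoints.

(** * From a bounded gradient to a Lipschitz bound *)

Section Lipschitz.
Context {R : realType} (T : triangle R) (f : R * R -> R).

(** Convexity keeps the segment from [x] to [y] in [T], so the mean value theorem applies along it.
    Since [f] is differentiable only relative to [T], the derivative is claimed at interior
    parameters, and continuity within the closed interval. *)
Lemma bounded_derivative_lipschitz : bounded_first_derivative (closed_triangle T) f ->
  exists L : R, 0 <= L /\ forall x y, closed_triangle T x -> closed_triangle T y ->
    `|f y - f x| <= L * (`|y.1 - x.1| + `|y.2 - x.2|).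
Proof.
move=> [g [gd [M gM]]]; exists `|M|; split=> // x y Tx Ty.
pose v : R * R := y - x.
pose gam (t : R) : R * R := x + t *: v.
pose phi t := f (gam t).
pose df t := (g (gam t)).1 * v.1 + (g (gam t)).2 * v.2.
have gamT (t : R) : 0 <= t <= 1 -> closed_triangle T (gam t).
  by move=> t01; exact: triangle_convex.
have gamB (s t : R) : gam s - gam t = (s - t) *: v.
  by rewrite /gam opprD addrACA subrr add0r -scalerBl.
have key (t e : R) : 0 <= t <= 1 -> 0 < e -> \forall s \near t, 0 <= s <= 1 ->
    `|phi s - phi t - (s - t) * df t| <= e * `|s - t|.
  move=> t01 e0.
  (* The added 1 keeps the divisor positive when [x = y]. *)
  have v0 : 0 < `|v| + 1 by rewrite ltr_wpDl.
  have /eqoP h := gd (gam t) (gamT t t01).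
  have := h (e / (`|v| + 1)) (divr_gt0 e0 v0).
  have cgam : {for t, continuous gam}.
    have c1 : (x.1 + s * v.1 : R) @[s --> t] --> (x.1 + t * v.1 : R).
      by apply: cvgD; [exact: cvg_cst|apply: cvgM; [exact: cvg_id|exact: cvg_cst]].
    have c2 : (x.2 + s * v.2 : R) @[s --> t] --> (x.2 + t * v.2 : R).
      by apply: cvgD; [exact: cvg_cst|apply: cvgM; [exact: cvg_id|exact: cvg_cst]].
    exact: (cvg_pair c1 c2).
  move=> /cgam hn; apply: (@filterS _ (nbhs t) _ _ _ _ hn) => s hs s01.
  have := hs (gamT s s01).
  have -> : (gam s).1 - (gam t).1 = (s - t) * v.1.
    by have := congr1 fst (gamB s t).
  have -> : (gam s).2 - (gam t).2 = (s - t) * v.2.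
    by have := congr1 snd (gamB s t).
  rewrite gamB normrZ => hs'.
  rewrite (_ : _ - _ - _ = f (gam s) - f (gam t) -
     ((g (gam t)).1 * ((s - t) * v.1) + (g (gam t)).2 * ((s - t) * v.2))); last first.
    by rewrite /phi /df; ring.
  apply: (le_trans hs').
  have bound (a b : R) : 0 <= a -> 0 <= b -> e / (a + 1) * (b * a) <= e * b.
    move=> a0 b0; have a1 : 0 < a + 1 by rewrite ltr_wpDl.
    rewrite (_ : _ * _ = e * b * (a / (a + 1))); last by field; rewrite gt_eqF.
    apply: ler_piMr; first by rewrite mulr_ge0// ltW.
    by rewrite ler_pdivrMr// mul1r lerDl.
  exact: bound.
have dphi (t : R) : t \in `]0, 1[ -> is_derive t 1 phi (df t).
  rewrite in_itv /= => /andP[t0 t1].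
  have cv : (h^-1 *: (phi (h *: 1 + t) - phi t)) @[h --> 0^'] --> df t.
    apply/cvgrPdist_le => e e0.
    have t01 : 0 <= t <= 1 by rewrite !ltW.
    have /nbhs0P near1 := key t e t01 e0.
    have near2 : \forall h \near (0 : R), 0 <= t + h <= 1.
      have : \forall s \near t, 0 <= s <= 1.
        near=> s; apply/andP; split; apply/ltW.
          by near: s; exact: lt_nbhsr.
        by near: s; exact: lt_nbhsl.
      by move/nbhs0P.
    rewrite near_withinE; near=> h => h0.
    have {}h1 : 0 <= t + h <= 1 -> `|phi (t + h) - phi t - (t + h - t) * df t| <= e * `|t + h - t|.
      by near: h.
    have {}h2 : 0 <= t + h <= 1 by near: h.
    have {h1} := h1 h2; rewrite (_ : t + h - t = h) => [h1|]; last by ring.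
    rewrite -(ler_pM2r (_ : 0 < `|h|)) ?normr_gt0// -normrM.
    rewrite (_ : _ * h = - (phi (t + h) - phi t - h * df t)); first by rewrite normrN.
    by rewrite /GRing.scale /= mulr1 (addrC h t); field.
  apply: DeriveDef; first by apply/cvg_ex; exists (df t).
  exact: cvg_lim.
have cphi : {within `[0, 1], continuous phi}.
  apply/subspace_continuousP => t; rewrite /= in_itv /= => t01.
  apply/cvgrPdist_le => e e0.
  (* With [e = 1] the estimate gives |phi s - phi t| <= (1 + |df t|) |s - t|. *)
  have near1 := key t 1 t01 ltr01.
  pose c := 1 + `|df t|.
  have c0 : 0 < c by rewrite ltr_pwDl.
  have near2 : \forall s \near t, `|s - t| <= e / c.
    have /cvgrPdist_le/(_ _ (divr_gt0 e0 c0)) : id @ t --> t by exact: cvg_id.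
    by apply: filterS => s /=; rewrite distrC.
  rewrite near_withinE; near=> s; rewrite /= in_itv /= => s01.
  have h1 : 0 <= s <= 1 -> `|phi s - phi t - (s - t) * df t| <= 1 * `|s - t| by near: s.
  have h2 : `|s - t| <= e / c by near: s.
  have {}h1 := h1 s01; rewrite mul1r in h1.
  rewrite distrC (_ : phi s - phi t = (phi s - phi t - (s - t) * df t) + (s - t) * df t); last by ring.
  apply: (le_trans (ler_normD _ _)); apply: (le_trans (lerD h1 (lexx _))).
  rewrite normrM -{1}[`|s - t|]mulr1 -mulrDr -/c.
  by rewrite -ler_pdivlMr.
have [c /= c01] := MVT_segment ler01 dphi cphi.
rewrite subr0 mulr1 /phi /gam scale0r addr0 scale1r /v.
rewrite (_ : x + (y - x) = y) => [->|]; last by rewrite addrC subrK.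
move: c01; rewrite in_itv /= => /gamT /gM gc.
have [g1 g2] : `|(g (gam c)).1| <= `|M| /\ `|(g (gam c)).2| <= `|M|.
  by split; apply: le_trans (ler_norm M); apply: le_trans gc; rewrite num_le_max lexx ?orbT.
rewrite mulrDr (le_trans (ler_normD _ _))// !normrM lerD// ler_wpM2r//.
Unshelve. all: by end_near. Qed.

End Lipschitz.

(** * Expectation of finitely valued variables *)

Section FiniteExpectation.
Context d (Omega : measurableType d) {R : realType} (P : probability Omega R).
Context (I : finType) (Z : Omega -> I).
Hypothesis Z_measurable : forall i, measurable (Z @^-1` [set i]).

Lemma measurable_finite_comp (h : I -> R) : measurable_fun setT (fun w => h (Z w)).
Proof.
move=> _ B mB; rewrite setTI.
rewrite (_ : _ @^-1` B = [set w | exists i, `[< B (h i) >] /\ (Z @^-1` [set i]) w]).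
  exact: measurable_exists.
apply/seteqP; split=> w; first by move=> Bw; exists (Z w); split=> //; apply/asboolP.
by move=> [i [/asboolP Bi /= Zi]]; rewrite /= Zi.
Qed.

Definition pmf i : R := fine (P (Z @^-1` [set i])).

Lemma pmfE i : P (Z @^-1` [set i]) = (pmf i)%:E.
Proof. by rewrite fineK// fin_num_measure. Qed.

Lemma pmf_ge0 i : 0 <= pmf i.
Proof. by rewrite fine_ge0. Qed.

Lemma sum_pmf : \sum_i pmf i = 1.
Proof.
have := measure_fiber_sum P predT (@measurableT _ Omega) Z_measurable.
rewrite setTI (eq_bigr (fun i => (pmf i)%:E)) => [|i _]; last by rewrite setTI; exact: pmfE.
rewrite (_ : [set x | _] = setT); last by apply/seteqP; split.
have PT : P setT = 1%E := probability_setT P.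
by move=> e; move: PT; rewrite e sumEFin => -[].
Qed.

Lemma integral_finite_comp (h : I -> R) :
  (\int[P]_w (h (Z w))%:E = (\sum_i h i * pmf i)%:E)%E.
Proof.
have cover : setT = \big[setU/set0]_(i <- index_enum I) (Z @^-1` [set i]).
  rewrite -bigcup_seq; apply/seteqP; split=> // w _.
  by exists (Z w) => //=; rewrite mem_index_enum.
rewrite cover integral_bigsetU_EFin//.
- rewrite -sumEFin; apply: eq_bigr => i _.
  rewrite (eq_integral (cst (h i)%:E)); last by move=> w; rewrite inE /= => ->.
  by rewrite integral_cst// EFinM -pmfE.
- exact: index_enum_uniq.
- by move=> i j _ _ [w [/= <- <-]].
- rewrite -cover; apply/measurable_EFinP; exact: measurable_finite_comp.
Qed.

Lemma integrable_finite_comp (h : I -> R) : P.-integrable setT (fun w => (h (Z w))%:E).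
Proof.
apply: measurable_bounded_integrable => //.
- by have := probability_setT P; rewrite /= => ->; rewrite ltry.
- exact: measurable_finite_comp.
- exists (\sum_i `|h i|); split; first by rewrite num_real.
  move=> x xh w _ /=; apply: le_trans (ltW xh).
  by rewrite (bigD1 (Z w))//= lerDl sumr_ge0.
Qed.

End FiniteExpectation.

(** * Lipschitz functions on cells *)

Section LipschitzIntegral.
Context {R : realType} (T : triangle R) (f : R * R -> R) (L : R).
Hypothesis T_det : triangle_det T != 0.
Hypothesis L_ge0 : 0 <= L.
Hypothesis f_lip : forall x y, closed_triangle T x -> closed_triangle T y ->
    `|f y - f x| <= L * (`|y.1 - x.1| + `|y.2 - x.2|).
Local Notation RR := (measurableTypeR R * measurableTypeR R)%type.
Local Notation S u := (closed_triangle (subtriangle T u)).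

(** Two coordinate differences, each at most twice [triangle_radius T], times the Lipschitz
    constant: a bound for the oscillation of [f] on [T], which halves at each level. *)
Definition osc : R := L * (4 * triangle_radius T).

Lemma lipschitz_osc u x y : S u x -> S u y -> `|f y - f x| <= osc * 2^-1 ^+ size u.
Proof.
move=> Sx Sy; have [h1 h2] := subtriangle_diam Sy Sx.
apply: (le_trans (f_lip (subtriangle_subset Sx) (subtriangle_subset Sy))).
rewrite /osc -mulrA ler_wpM2l//; lra.
Qed.

(** Superlevel sets are rebuilt from cells: for [x] in [T], [b <= f x] exactly when at every level
    some cell containing [x] has a point where [f] is at least [b]. *)
Lemma measurable_lipschitz : measurable_fun (closed_triangle T : set RR) (f : RR -> R).
Proof.
have mT := measurable_triangle T_det.
apply: (measurability _ (RGenCInfty.measurableE R)) => _ [_ [b ->] <-].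
pose p K (c : K.-tuple 'I_4) := `[< exists y, S c y /\ b <= f y >].
have -> : (closed_triangle T : set RR) `&` f @^-1` `[b, +oo[%classic =
    closed_triangle T `&` \bigcap_K [set x : RR | exists c : K.-tuple 'I_4, p K c /\ S c x].
  apply/seteqP; split=> x [Tx].
    rewrite /= in_itv /= andbT => bx; split=> // K _.
    have [c cx] := subtriangle_cover K Tx.
    by exists c; split=> //; apply/asboolP; exists x.
  move=> Hx; split=> //; rewrite /= in_itv /= andbT -subr_le0.
  apply: (@le_half_pow _ osc) => K.
  have [c [/asboolP[y [cy bfy]] cx]] := Hx K I.
  have := lipschitz_osc cx cy; rewrite size_tuple ler_norml; lra.
apply: measurableI => //; apply: bigcapT_measurable => K.
by apply: measurable_exists => c; exact: measurable_subtriangle.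
Qed.

Lemma lipschitz_bounded x : closed_triangle T x -> `|f x| <= `|f (vA T)| + osc.
Proof.
move=> Tx; have := @lipschitz_osc [::] _ _ (triangle_vA T) Tx.
rewrite expr0 mulr1 => h.
rewrite (_ : f x = f (vA T) + (f x - f (vA T))); last by ring.
by rewrite (le_trans (ler_normD _ _))// lerD2l.
Qed.

End LipschitzIntegral.

(** * The mean square error *)

Section MeanSquareError.
Context {R : realType} (T : triangle R).
Hypothesis T_det : triangle_det T != 0.
Hypothesis T_area : lebesgue2 R (closed_triangle T) = 1%E.
Context {d : measure_display} {Omega : measurableType d} (P : probability Omega R).
Variable pi : seq 'I_4 -> Omega -> {perm 'I_4}.
Hypothesis pi_scrambling : nested_uniform_scrambling P pi.
Variables (f : R * R -> R) (L : R).
Hypothesis L_ge0 : 0 <= L.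
Hypothesis f_lip : forall x y, closed_triangle T x -> closed_triangle T y ->
    `|f y - f x| <= L * (`|y.1 - x.1| + `|y.2 - x.2|).
Local Notation RR := (measurableTypeR R * measurableTypeR R)%type.
Local Notation S u := (closed_triangle (subtriangle T u)).
Local Notation point n := (scrambled_point T pi n.+1 : Omega -> RR).
Local Notation scrambled K n w := (scrambled_digits pi K n.+1 w).
Local Notation osc := (osc T L).

Definition vertex_value (u : seq 'I_4) : R := f (vA (subtriangle T u)).

Variable k : nat.
Local Notation tail n j := (tail_digits pi n j k).
Local Notation word := (k.-tuple 'I_4).

(** The conditional mean of [vertex_value] at level 2k given the first k digits [s], the other k
    being uniform. *)
Definition mean_value (s : word) : R := (\sum_(c : word) vertex_value (s ++ c)) / 4 ^+ k.

Lemma vertex_value_osc (s c c' : word) :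
  `|vertex_value (s ++ c) - vertex_value (s ++ c')| <= osc * 2^-1 ^+ k.
Proof.
have vin (b : word) : S s (vA (subtriangle T (s ++ b))).
  by rewrite subtriangle_cat; apply: subtriangle_subset; exact: triangle_vA.
by have := lipschitz_osc L_ge0 f_lip (vin c') (vin c); rewrite size_tuple.
Qed.

Lemma sum_word_cst (x : R) : \sum_(c : word) x = 4 ^+ k * x.
Proof. by rewrite sumr_const card_words -[_ *+ _]mulr_natl natrX. Qed.

Lemma pow4_gt0 : 0 < 4 ^+ k :> R. Proof. by rewrite exprn_gt0. Qed.

Definition deviation (z : word * word) : R := vertex_value (z.1 ++ z.2) - mean_value z.1.

Lemma deviation_bound z : `|deviation z| <= osc * 2^-1 ^+ k.
Proof.
have p4 := pow4_gt0.
have -> : deviation z =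
   (\sum_(c : word) (vertex_value (z.1 ++ z.2) - vertex_value (z.1 ++ c))) / 4 ^+ k.
  by rewrite sumrB sum_word_cst /deviation /mean_value mulrBl mulrAC divff ?mul1r.
rewrite normrM [`|_^-1|]gtr0_norm ?invr_gt0// ler_pdivrMr// mulrC -sum_word_cst.
apply: (le_trans (ler_norm_sum _ _ _)); apply: ler_sum => c _.
exact: vertex_value_osc.
Qed.

Lemma sum_deviation s : \sum_(c : word) deviation (s, c) = 0.
Proof.
by rewrite /deviation /= sumrB sum_word_cst /mean_value mulrCA divff ?mulr1 ?subrr.
Qed.

Definition address (n : nat) (w : Omega) : word * word := (tail n 0 w, tail n k w).

Lemma satisfied_address n (z : word * word) :
  address n @^-1` [set z] =
  satisfied pi (digit_constraints n 0 z.1 ++ digit_constraints n k z.2).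
Proof.
rewrite satisfied_cat -!tail_digits_fiber; case: z => s c.
by apply/seteqP; split=> w /=; [move=> [<- <-]|move=> [<- <-]].
Qed.

Lemma measurable_address n z : measurable (address n @^-1` [set z]).
Proof. by rewrite satisfied_address; exact: (measurable_satisfied pi_scrambling). Qed.

Lemma scrambled_address n w : scrambled (k + k) n w = (address n w).1 ++ (address n w).2.
Proof. exact: scrambled_digits_add. Qed.

Lemma point_vertex_error n w :
  `|f (point n w) - vertex_value ((address n w).1 ++ (address n w).2)| <= osc / 4 ^+ k.
Proof.
rewrite -scrambled_address.
have := lipschitz_osc L_ge0 f_lip (triangle_vA _) (scrambled_point_in T_det pi n (k + k) w).
have e4 : 2^-1 ^+ 2 = 4^-1 :> R by field.
by rewrite size_mkseq addnn -mul2n exprM e4 exprVn.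
Qed.

Lemma prob_split_tail Cs n (c : word) :
  (forall j, j \in map fst Cs -> ~~ tail_word n k j) ->
  P (satisfied pi Cs `&` tail n k @^-1` [set c]) = (P (satisfied pi Cs) * (4^-1 ^+ k)%:E)%E.
Proof.
move=> hC.
have indep : independent_off P pi [pred u | u \in map fst Cs] (satisfied pi Cs).
  by apply: (independent_off_satisfied pi_scrambling) => c' c'C; exact: map_f.
rewrite tail_digits_fiber indep.2 ?size_mkseq ?size_tuple//.
  exact: uniq_digit_constraints.
move=> _ /mapP[l _ ->] /=; apply/negP => /hC.
by rewrite tail_word_digits.
Qed.

Lemma prob_satisfied_uniq Cs : uniq (map fst Cs) ->
  P (satisfied pi Cs) = (4^-1 ^+ size Cs)%:E.
Proof.
move=> uC.
have [_ /(_ Cs uC)] : independent_off P pi pred0 (satisfied pi [::]).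
  exact: (independent_off_satisfied pi_scrambling).
by rewrite satisfied_nil setTI => ->//; rewrite probability_setT mul1e.
Qed.

Lemma head_word_not_tail n m (s : word) u :
  u \in map fst (digit_constraints n 0 s) -> ~~ tail_word m k u.
Proof.
move=> /mapP[_ /mapP[l + ->] ->] /=; rewrite mem_iota add0n size_tuple /= => lk.
by rewrite /tail_word size_digits add0n leqNgt lk.
Qed.

Lemma prob_address n z : P (address n @^-1` [set z]) = (4^-1 ^+ k * 4^-1 ^+ k)%:E.
Proof.
rewrite satisfied_address satisfied_cat -(tail_digits_fiber _ n k) prob_split_tail.
  rewrite prob_satisfied_uniq; last exact: uniq_digit_constraints.
  by rewrite size_mkseq size_tuple -EFinM.
by move=> u; exact: head_word_not_tail.
Qed.

(** Only the last [k] digits of [n] are split off, leaving a weight that does not involve [c]. The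
    leading digits of [n] and [m] share permutations, so their joint probability stays
    unevaluated. *)
Lemma prob_address_pair n m s c z : (n < 4 ^ k)%N -> (m < 4 ^ k)%N -> n != m ->
  P ((fun w => (address n w, address m w)) @^-1` [set ((s, c), z)]) =
  (P (tail n 0 @^-1` [set s] `&` address m @^-1` [set z]) * (4^-1 ^+ k)%:E)%E.
Proof.
move=> nk mk nm.
have -> : tail n 0 @^-1` [set s] `&` address m @^-1` [set z] =
    satisfied pi (digit_constraints n 0 s ++
                  (digit_constraints m 0 z.1 ++ digit_constraints m k z.2)).
  by rewrite satisfied_address tail_digits_fiber [RHS]satisfied_cat.
rewrite -(@prob_split_tail _ n c).
  congr (P _); rewrite satisfied_cat -satisfied_address -tail_digits_fiber.
  apply/seteqP; split=> w /=; first by move=> [<- <- <-].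
  by rewrite /address => -[[-> ->] ->].
move=> u; rewrite !map_cat !mem_cat => /or3P[|uz|].
- exact: head_word_not_tail.
- exact: head_word_not_tail uz.
- by move=> /mapP[_ /mapP[l _ ->] ->] /=; exact: tail_word_disjoint.
Qed.

Definition addresses (w : Omega) : {ffun 'I_(4 ^ k) -> word * word} :=
  [ffun i : 'I_(4 ^ k) => address i w].

Local Notation table := {ffun 'I_(4 ^ k) -> word * word}.

Lemma measurable_addresses (z : table) : measurable (addresses @^-1` [set z]).
Proof.
have -> : addresses @^-1` [set z] =
    \big[setI/setT]_(i : 'I_(4 ^ k)) (address i @^-1` [set z i]).
  rewrite -bigcap_seq; apply/seteqP; split=> w.
    by move=> /= <- i _ /=; rewrite ffunE.
  by move=> h; apply/ffunP => i; rewrite ffunE; apply: (h i); rewrite /= mem_index_enum.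
by apply: bigsetI_measurable => i _; exact: measurable_address.
Qed.

Local Notation prob := (pmf P addresses).

(* Given everything else, the last [k] digits of the point [i] are uniform, and
   the deviation averages to zero over them. *)
Lemma deviation_uncorrelated (i j : 'I_(4 ^ k)) : i != j ->
  \sum_(z : table) deviation (z i) * deviation (z j) * prob z = 0.
Proof.
move=> ij.
pose pairing w := (address i w, address j w).
have mpair q : measurable (pairing @^-1` [set q]).
  have -> : pairing @^-1` [set q] = address i @^-1` [set q.1] `&` address j @^-1` [set q.2].
    case: q => a b; apply/seteqP; split=> w /=; first by move=> [<- <-].
    by rewrite /pairing => -[-> ->].
  by apply: measurableI; exact: measurable_address.
have := integral_finite_comp P measurable_addresses (fun z => deviation (z i) * deviation (z j)).
have -> : (fun w => (deviation (addresses w i) * deviation (addresses w j))%:E) =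
          (fun w => ((fun q => deviation q.1 * deviation q.2) (pairing w))%:E).
  by apply/funext => w; rewrite !ffunE.
rewrite (integral_finite_comp P mpair (fun q => deviation q.1 * deviation q.2)) => -[<-].
pose r s z := fine (P (tail i 0 @^-1` [set s] `&` address j @^-1` [set z])).
have pairE s c z : pmf P pairing ((s, c), z) = r s z * 4^-1 ^+ k.
  rewrite /pmf prob_address_pair//.
  rewrite fineM//; apply: fin_num_measure; apply: measurableI.
    exact: (measurable_tail_digits pi_scrambling).
  exact: measurable_address.
rewrite (eq_bigr (fun q => (fun x z => deviation x * deviation z * pmf P pairing (x, z)) q.1 q.2)); last by case.
rewrite -(pair_bigA _ (fun x z => deviation x * deviation z * pmf P pairing (x, z))) /=.
rewrite exchange_big big1//= => z _.
rewrite (eq_bigr (fun x => (fun s c => deviation (s, c) * deviation z * pmf P pairing ((s, c), z)) x.1 x.2)); last by case.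
rewrite -(pair_bigA _ (fun s c => deviation (s, c) * deviation z * pmf P pairing ((s, c), z))) /=.
rewrite big1//= => s _.
under eq_bigr do rewrite pairE -mulrA.
by rewrite -mulr_suml sum_deviation mul0r.
Qed.

(** Only the 4^k diagonal terms survive, each at most the square of [osc * 2^-1 ^+ k], that is osc^2
    / 4^k. *)
Lemma deviation_second_moment :
  \sum_(z : table) (\sum_(i < 4 ^ k) deviation (z i)) ^+ 2 * prob z <= osc ^+ 2.
Proof.
under eq_bigr do rewrite expr2 mulr_suml mulr_suml.
rewrite exchange_big /=.
have diag i : \sum_(z : table) deviation (z i) * (\sum_(j < 4 ^ k) deviation (z j)) * prob z
    <= osc ^+ 2 / 4 ^+ k.
  under eq_bigr do rewrite mulr_sumr mulr_suml.
  rewrite exchange_big /= (bigD1 i)//= [X in _ + X]big1 => [|j ji]; last first.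
    by rewrite deviation_uncorrelated// eq_sym.
  rewrite addr0; apply: (@le_trans _ _ (osc ^+ 2 / 4 ^+ k * \sum_(z : table) prob z)); last first.
    by rewrite (sum_pmf P measurable_addresses) mulr1.
  rewrite mulr_sumr.
  apply: ler_sum => z _; apply: ler_wpM2r; first exact: pmf_ge0.
  have e4 : 2^-1 ^+ 2 = 4^-1 :> R by field.
  rewrite (_ : osc ^+ 2 / 4 ^+ k = (osc * 2^-1 ^+ k) ^+ 2); last first.
    by rewrite [RHS]exprMn -[in RHS]exprM mulnC exprM e4 exprVn.
  have h := deviation_bound (z i).
  have h0 : 0 <= osc * 2^-1 ^+ k := le_trans (normr_ge0 _) h.
  by rewrite -expr2 -[leLHS]real_normK ?num_real// ler_pXn2r// nnegrE.
apply: (le_trans (ler_sum _ (fun i _ => diag i))).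
rewrite sumr_const card_ord -[_ *+ _]mulr_natl natrX mulrCA divff ?mulr1//.
Qed.

(** In every outcome the leading words of the points run through all words of length k once, so the
    sum of the cell means is not random. *)
Lemma sum_mean_value w :
  \sum_(i < 4 ^ k) mean_value (address i w).1 = \sum_(s : word) mean_value s.
Proof.
have finj : injective (fun i : 'I_(4 ^ k) => tail i 0 w).
  move=> i j /(congr1 val) /= fij; apply: val_inj.
  exact: (scrambled_digits_inj (ltn_ord i) (ltn_ord j) fij).
have fbij : bijective (fun i : 'I_(4 ^ k) => tail i 0 w).
  by apply: inj_card_bij => //; rewrite card_words card_ord.
by rewrite [RHS](reindex _ (onW_bij _ fbij)).
Qed.

(** Case [k = 0] of the one-point step, starting from the sure event. *)
Lemma point_law0 n (B : set RR) : measurable B ->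
  P (point n @^-1` B) = lebesgue2 R (B `&` closed_triangle T).
Proof.
move=> mB.
have indep : independent_off P pi pred0 (satisfied pi [::]).
  exact: (independent_off_satisfied pi_scrambling).
have := independent_off_point T_det T_area pi_scrambling (n := n) (k := 0) (s := [::]) indep erefl.
move=> /(_ (fun _ => isT) (fun _ _ => erefl) B mB) [+ _].
by rewrite satisfied_nil setTI => ->; rewrite probability_setT expr0 !mul1e.
Qed.

(** [f] is arbitrary off [T]; its extension by zero is measurable on the plane and agrees with [f]
    at every scrambled point. *)
Definition patched : RR -> R := f \_ (closed_triangle T).

Lemma measurable_patched : measurable_fun setT patched.
Proof.
apply/(measurable_restrictT _ (measurable_triangle T_det)).
exact: (measurable_lipschitz T_det L_ge0 f_lip).
Qed.

Lemma point_in n w : closed_triangle T (point n w).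
Proof. exact: (scrambled_point_in T_det pi n 0 w). Qed.

Lemma patched_point n w : patched (point n w) = f (point n w).
Proof. by rewrite /patched patchE mem_set//; exact: point_in. Qed.

Lemma measurable_f_point n : measurable_fun setT (fun w => f (point n w)).
Proof.
rewrite (_ : (fun w => _) = patched \o point n).
  apply: measurableT_comp; first exact: measurable_patched.
  exact: (measurable_scrambled_point T_det pi_scrambling).
by apply/funext => w /=; rewrite patched_point.
Qed.

Lemma integrable_f_point n : P.-integrable setT (fun w => (f (point n w))%:E).
Proof.
apply: measurable_bounded_integrable => //.
- by have := probability_setT P; rewrite /= => ->; rewrite ltry.
- exact: measurable_f_point.
- exists (`|f (vA T)| + osc); split; first by rewrite num_real.
  move=> x xh w _ /=; apply: le_trans (ltW xh).
  by apply: (lipschitz_bounded L_ge0 f_lip); exact: point_in.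
Qed.

(** A single scrambled point is uniform on [T]. Writing the integral as an expectation lets the
    vertex values approximate it too. *)
Lemma integral_triangle :
  (\int[lebesgue2 R]_(x in closed_triangle T) (f x)%:E = \int[P]_w (f (point 0 w))%:E)%E.
Proof.
have mT := measurable_triangle T_det.
have mX := measurable_scrambled_point T_det pi_scrambling 0.
have XT : point 0 @^-1` closed_triangle T = setT.
  by apply/seteqP; split=> // w _; exact: point_in.
pose m' : {measure set RR -> \bar R} := pushforward P (point 0).
pose m := m' mX.
transitivity (\int[lebesgue2 R]_(x in closed_triangle T) (patched x)%:E)%E.
  by apply: eq_integral => x xT; rewrite /patched patchE xT.
transitivity (\int[m]_(x in closed_triangle T) (patched x)%:E)%E.
  apply: eq_measure_integral => A mA AT.
  by rewrite -[in LHS](setIidl AT); exact: (esym (point_law0 0 mA)).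
have fE : (fun w => (patched (point 0 w))%:E) = (fun w => (f (point 0 w))%:E).
  by apply/funext => w; rewrite patched_point.
rewrite (integral_pushforward mX) //=.
- by rewrite XT; congr (integral _ _ _).
- by apply/measurable_EFinP; exact: measurable_patched.
- by rewrite XT /comp fE; exact: integrable_f_point.
Qed.

Lemma integral_error : `|(\sum_(s : word) mean_value s) / 4 ^+ k -
  \int[lebesgue2 R]_(x in closed_triangle T) f x| <= osc / 4 ^+ k.
Proof.
pose e := osc / 4 ^+ k.
pose v (z : word * word) := vertex_value (z.1 ++ z.2).
pose mu := (\sum_(s : word) mean_value s) / 4 ^+ k.
(* The shifts [h = e] and [h = - e] will sandwich the integral, as [f] at the point is within [e] of
   [v]. *)
have moment (h : R) : \sum_z (v z + h) * pmf P (address 0) z = mu + h.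
  under eq_bigr do rewrite mulrDl.
  rewrite big_split /= -mulr_sumr sum_pmf ?mulr1; last exact: measurable_address.
  congr (_ + _); rewrite /mu mulr_suml.
  rewrite (eq_bigr (fun z => (fun s c => v (s, c) * (4^-1 ^+ k * 4^-1 ^+ k)) z.1 z.2)); last first.
    by move=> -[s c] _; rewrite /pmf prob_address.
  rewrite -(pair_bigA _ (fun s c => v (s, c) * (4^-1 ^+ k * 4^-1 ^+ k))) /=.
  apply: eq_bigr => s _; rewrite /mean_value !exprVn mulr_suml mulr_suml.
  by apply: eq_bigr => c _; rewrite mulrA.
have err w : `|f (point 0 w) - v (address 0 w)| <= e by exact: point_vertex_error.
have lower : ((mu - e)%:E <= \int[P]_w (f (point 0 w))%:E)%E.
  rewrite -(moment (- e)) -(integral_finite_comp P (measurable_address 0)).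
  apply: le_integral => //; last 2 first.
  - exact: integrable_f_point.
  - by move=> w _; rewrite lee_fin; have := err w; rewrite ler_norml; lra.
  exact: (integrable_finite_comp P (measurable_address 0) (fun z => v z - e)).
have upper : (\int[P]_w (f (point 0 w))%:E <= (mu + e)%:E)%E.
  rewrite -(moment e) -(integral_finite_comp P (measurable_address 0)).
  apply: le_integral => //; first exact: integrable_f_point.
    exact: (integrable_finite_comp P (measurable_address 0) (fun z => v z + e)).
  by move=> w _; rewrite lee_fin; have := err w; rewrite ler_norml; lra.
rewrite /Rintegral integral_triangle -/mu -/e.
have fin := integrable_fin_num measurableT (integrable_f_point 0).
move: lower upper; rewrite -(fineK fin) !lee_fin /= ler_norml.
by move=> ? ?; apply/andP; split; lra.
Qed.

(** From (D + s)^2 <= 2 D^2 + 2 s^2 with s = a + b and |s| <= 2e, whence the 8. *)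
Lemma square_of_sum (D a b e : R) : `|a| <= e -> `|b| <= e ->
  (D + a + b) ^+ 2 <= 2 * D ^+ 2 + 8 * e ^+ 2.
Proof.
rewrite !ler_norml => /andP[a1 a2] /andP[b1 b2].
have : (a + b) ^+ 2 <= (2 * e) ^+ 2.
  by rewrite -[leLHS]real_normK ?num_real// ler_sqr ?nnegrE ?ler_norml//; lra.
by have := sqr_ge0 (D - (a + b)); nra.
Qed.

Lemma mean_square_error :
  (\int[P]_w (((4 ^ k)%:R^-1 * (\sum_(i < 4 ^ k) f (point i w)) -
     \int[lebesgue2 R]_(x in closed_triangle T) f x) ^+ 2)%:E
   <= (10 * osc ^+ 2 / (4 ^ k)%:R ^+ 2)%:E)%E.
Proof.
rewrite natrX; set I := \int[_]_(_ in _) _.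
have p4 := pow4_gt0; set N : R := 4 ^+ k in p4 *.
(* A finitely valued dominating function, whose expectation is a finite sum over tables. *)
pose g (z : table) := 2 * (N^-1 * \sum_(i < 4 ^ k) deviation (z i)) ^+ 2 + 8 * (osc / N) ^+ 2.
apply: (@le_trans _ _ (\int[P]_w (g (addresses w))%:E)%E).
  apply: ge0_le_integral => //.
  - by move=> w _; rewrite lee_fin sqr_ge0.
  - apply/measurable_EFinP; apply: measurable_funX; apply: measurable_funB => //.
    apply: measurable_funM => //; apply: measurable_sum => i.
    exact: measurable_f_point.
  - apply/measurable_EFinP; apply: measurable_finite_comp; exact: measurable_addresses.
  move=> w _; rewrite lee_fin /g.
  pose D := N^-1 * \sum_(i < 4 ^ k) deviation (addresses w i).
  pose mu := (\sum_(s : word) mean_value s) / N.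
  (* Fluctuation within cells, truncation error at the points, and discretisation error of the
     integral; the last two are at most osc / N each. *)
  have split_error : N^-1 * (\sum_(i < 4 ^ k) f (point i w)) - I =
      D + N^-1 * (\sum_(i < 4 ^ k) (f (point i w) - vertex_value ((address i w).1 ++ (address i w).2)))
      + (mu - I).
    rewrite /mu -(sum_mean_value w) [_ / N]mulrC /D.
    rewrite [X in _ = X + _]addrC -mulrDr -big_split /= addrA -mulrDr -big_split /=.
    congr (_ * _ - _); apply: eq_bigr => i _; rewrite ffunE /deviation; ring.
  have err1 : `|N^-1 * (\sum_(i < 4 ^ k) (f (point i w) -
      vertex_value ((address i w).1 ++ (address i w).2)))| <= osc / N.
    rewrite normrM gtr0_norm ?invr_gt0// mulrC ler_pdivrMr//.
    apply: (le_trans (ler_norm_sum _ _ _)).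
    apply: (@le_trans _ _ (\sum_(i < 4 ^ k) osc / N)).
      by apply: ler_sum => i _; exact: point_vertex_error.
    by rewrite sumr_const card_ord -[_ *+ _]mulr_natl natrX mulrC.
  have err2 : `|mu - I| <= osc / N by exact: integral_error.
  by rewrite split_error; exact: square_of_sum.
rewrite (integral_finite_comp P measurable_addresses) lee_fin.
rewrite (eq_bigr (fun z : table => 2 / N ^+ 2 * ((\sum_(i < 4 ^ k) deviation (z i)) ^+ 2 * prob z) +
    8 * (osc / N) ^+ 2 * prob z)); last first.
  by move=> z _; rewrite /g exprMn exprVn; ring.
rewrite big_split /= -!mulr_sumr (sum_pmf P measurable_addresses) mulr1.
have := deviation_second_moment; set m := \sum_z _ => hm.
have N2 : 0 < N ^+ 2 by rewrite exprn_gt0.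
(* The 10 is 2 from the second moment of the deviations plus 8 from the two remaining errors. *)
rewrite expr_div_n (_ : 10 * osc ^+ 2 / N ^+ 2 = 2 / N ^+ 2 * osc ^+ 2 + 8 * (osc ^+ 2 / N ^+ 2)).
  by rewrite lerD2r ler_wpM2l// divr_ge0// ltW.
by field; rewrite gt_eqF.
Qed.

End MeanSquareError.

Theorem mainTheorem6 (R : realType) (T : triangle R)
    (T_equilateral : equilateral T)
    (T_area : lebesgue2 R (closed_triangle T) = 1%E)
    (d : measure_display) (Omega : measurableType d) (P : probability Omega R)
    (pi : seq 'I_4 -> Omega -> {perm 'I_4})
    (pi_scrambling : nested_uniform_scrambling P pi) :
  (* Every level-k subtriangle is that of exactly one of the N points, each
     point lies in its subtriangle, and, conditionally on which subtriangle
     each point is assigned to, the points are independent and uniformly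
     distributed within their subtriangles. *)
  (forall k : nat,
     [/\ forall (w : Omega) (e : k.-tuple 'I_4),
           exists! i : 'I_(4 ^ k), scrambled_digits pi k i.+1 w = e,
         forall (w : Omega) (i : 'I_(4 ^ k)),
           closed_triangle (subtriangle T (scrambled_digits pi k i.+1 w))
             (scrambled_point T pi i.+1 w)
       & forall s : 'I_(4 ^ k) -> seq 'I_4,
           let E := [set w | forall i : 'I_(4 ^ k),
                               scrambled_digits pi k i.+1 w = s i] in
           (0 < P E)%E ->
           mutually_independent
             (@measurable _ (measurableTypeR R * measurableTypeR R)%type)
             (conditional P E)
             (fun i : 'I_(4 ^ k) => scrambled_point T pi i.+1) /\
           forall i : 'I_(4 ^ k),
             uniform_on (closed_triangle (subtriangle T (s i)))
               (conditional P E) (scrambled_point T pi i.+1)]) /\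
  (forall f : R * R -> R,
     bounded_first_derivative (closed_triangle T) f ->
     exists C : R, forall k : nat,
       let N := (4 ^ k)%N in
       ('E_P[fun w : Omega =>
              ((N%:R^-1 * (\sum_(1 <= i < N.+1) f (scrambled_point T pi i w))
               - \int[lebesgue2 R]_(x in closed_triangle T) f x) ^+ 2)%R]
        <= (C / N%:R ^+ 2)%:E)%E).
Proof.
have T_det := equilateral_det_neq0 T_equilateral T_area.
split=> [k|f /bounded_derivative_lipschitz[L [L0 f_lip]]].
  split.
  - by move=> w e; exact: scrambled_digits_bij.
  - by move=> w i; exact: scrambled_point_in.
  - by move=> s E E0; exact: conditional_law.
exists (10 * osc T L ^+ 2) => k; cbv zeta; rewrite unlock.
(* Points are numbered from 1, whereas the lemmas index them by the number whose digits are
   scrambled, from 0. *)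
under eq_integral do rewrite big_add1 big_mkord.
exact: mean_square_error.
Qed.
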